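(* Let $s\in\{+1,-1\}$ and $\alpha\ge\beta\ge-\tfrac12$. Then $$\mathbb B_s(I;\alpha,\beta)\ \ge\ \frac{2\,\Gamma(\alpha+2)^{\frac{2}{\alpha+1}}}{(4e^{1/12})^{\frac{2}{\alpha+1}}(\alpha+\beta+2)(\alpha+2)}.$$ Moreover $\mathbb B_+(I;\alpha,\beta)\le2$ and $\mathbb B_-(I;\alpha,\beta)\le8$.
   Context: $I=[-1,1]$. For $\alpha,\beta>-1$, $w_{\alpha,\beta}(x)=c_{\alpha,\beta}(1-x)^\alpha(1+x)^\beta$ on $I$, with $c_{\alpha,\beta}$ chosen so that $w_{\alpha,\beta}(x)dx$ is a probability measure. $P^{(\alpha,\beta)}_n$ are the Jacobi polynomials (degree $n$, orthogonal on $I$ with respect to $w_{\alpha,\beta}$, normalized by $P^{(\alpha,\beta)}_n(1)=\binom{n+\alpha}{n}$), and $p^{(\alpha,\beta)}_n=P^{(\alpha,\beta)}_n/\|P^{(\alpha,\beta)}_n\|_{L^2(w_{\alpha,\beta})}$ is the orthonormal basis of $L^2(I,w_{\alpha,\beta})$. For real $f\in L^2(I,w_{\alpha,\beta})$, $\widehat f(n)=\int_I f\,p^{(\alpha,\beta)}_n w_{\alpha,\beta}\,dx$. $\mathcal B_s(I;\alpha,\beta)$ is the set of continuous $f:I\to\mathbb R$ with $\widehat f(0)\le0$, $\{s\widehat f(n)\}$ eventually nonnegative, and $sf(1)\le0$. For such $f$, $r(f;I)=\inf\{r\in(0,2]: f(x)\ge0\text{ for all }x\in[-1,1-r)\}$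 and $k(s\widehat f)=\min\{k\ge1: s\widehat f(n)\ge0\ \forall n\ge k\}$. $\mathbb B_s(I;\alpha,\beta)=\inf_{f\in\mathcal B_s(I;\alpha,\beta)\setminus\{0\}}r(f;I)\,k(s\widehat f)^2$. *)

(* Defs.v *)
From Stdlib Require Import Reals Lra Lia ClassicalEpsilon.
Open Scope R_scope.

(* x^a for x > 0 (real exponent); 0 elsewhere (only used on open intervals). *)
Definition rpow (x a : R) : R := if Rlt_dec 0 x then Rpower x a else 0.

Definition has_int_m11 (g : R -> R) (l : R) : Prop :=
  forall eps, 0 < eps -> exists d, 0 < d /\
    forall a b, -1 < a < -1 + d -> 1 - d < b < 1 ->
      exists pr : Riemann_integrable g a b, Rabs (RiemannInt pr - l) < eps.

Definition Int_m11 (g : R -> R) : R := epsilon (inhabits 0) (has_int_m11 g).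

Definition Gamma (a : R) : R :=
  epsilon (inhabits 0) (fun l =>
    forall eps, 0 < eps -> exists d, 0 < d /\ exists T0,
      forall e T, 0 < e < d -> T0 < T ->
        exists pr : Riemann_integrable (fun t => rpow t (a - 1) * exp (- t)) e T,
          Rabs (RiemannInt pr - l) < eps).

Fixpoint falling (a : R) (k : nat) : R :=
  match k with O => 1 | S k' => falling a k' * (a - INR k') end.
Definition gbinom (a : R) (k : nat) : R := falling a k / INR (Factorial.fact k).

(* Jacobi polynomial (DLMF 18.5.8):
   P_n(x) = sum_{l=0}^n C(n+al,l) C(n+be,n-l) ((x-1)/2)^(n-l) ((x+1)/2)^l,
   so that P_n(1) = C(n+al,n). *)
Definition jacobiP (al be : R) (n : nat) (x : R) : R :=
  sum_f_R0 (fun l => gbinom (INR n + al) l * gbinom (INR n + be) (n - l)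
                       * ((x - 1) / 2) ^ (n - l) * ((x + 1) / 2) ^ l) n.

Definition wraw (al be : R) (x : R) : R := rpow (1 - x) al * rpow (1 + x) be.
Definition cw (al be : R) : R := / Int_m11 (wraw al be).
Definition w (al be : R) (x : R) : R := cw al be * wraw al be x.

Definition jnorm (al be : R) (n : nat) : R :=
  sqrt (Int_m11 (fun x => (jacobiP al be n x) ^ 2 * w al be x)).
Definition jacobip (al be : R) (n : nat) (x : R) : R := jacobiP al be n x / jnorm al be n.

Definition fhat (al be : R) (f : R -> R) (n : nat) : R :=
  Int_m11 (fun x => f x * jacobip al be n x * w al be x).

Definition Iset (x : R) : Prop := -1 <= x <= 1.

Definition inB (s al be : R) (f : R -> R) : Prop :=
  (forall x, Iset x -> continue_in f Iset x) /\
  fhat al be f 0 <= 0 /\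
  (exists N, forall n, (N <= n)%nat -> 0 <= s * fhat al be f n) /\
  s * f 1 <= 0.

Definition is_glb (E : R -> Prop) (m : R) : Prop :=
  (forall x, E x -> m <= x) /\ (forall m', (forall x, E x -> m' <= x) -> m' <= m).

Definition rI (f : R -> R) : R :=
  epsilon (inhabits 0) (is_glb (fun r => 0 < r <= 2 /\
     forall x, -1 <= x < 1 - r -> 0 <= f x)).

Definition kidx (s al be : R) (f : R -> R) : nat :=
  let P := fun k : nat => forall n, (k <= n)%nat -> 0 <= s * fhat al be f n in
  epsilon (inhabits 0%nat) (fun k => (1 <= k)%nat /\ P k /\
     forall j, (1 <= j)%nat -> P j -> (k <= j)%nat).

Definition Bvals (s al be : R) (v : R) : Prop :=
  exists f : R -> R, inB s al be f /\ (exists x, Iset x /\ f x <> 0) /\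
    v = rI f * (INR (kidx s al be f)) ^ 2.

Definition inf_ge (E : R -> Prop) (L : R) : Prop := forall v, E v -> L <= v.
Definition inf_le (E : R -> Prop) (U : R) : Prop :=
  forall eps, 0 < eps -> exists v, E v /\ v < U + eps.

(* Main.v *)
Require Import Defs.
From Stdlib Require Import Reals Factorial Wf_nat Lra Lia ClassicalEpsilon.
From Coquelicot Require Import Coquelicot.
Open Scope R_scope.

(** Lower bound.  By positivity of [s * fhat n] for [n >= k], testing against the kernels
    [(1 + x)^N], whose Jacobi coefficients are nonnegative and which concentrate at [x = 1],
    gives [sum_n s * fhat n * p_n 1 <= s * f 1 <= 0].  Since [|p_n| <= p_n 1], this bounds
    [sum_n |fhat n| p_n 1], hence [|f|], by [2 K ||f||_1] with [K = sum_(n < k) (p_n 1)^2].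
    As the mean of [f] is at most 0, [||f||_1] is at most twice the integral of the negative part,
    which lives on [[1 - r, 1]]; so [1 <= 4 K w([1 - r, 1])].  Finally [K] is an explicit product of
    reciprocals of beta integrals, and these are bounded below by [Gamma (al + 2)].

    Upper bounds.  [p_1 - p_1 1] has [k = 1] for [s = 1], [p_1] has [k <= 2] for [s = -1],
    and [r <= 2] always. *)

(** * Integration against the Jacobi weight *)

(** Two obstacles shape the proof. First, [f] is merely continuous, so its Jacobi series need not
    converge pointwise. Every argument therefore pairs [f] with a polynomial kernel, for which the
    expansion is a finite sum, and passes to the limit only in the kernel: the normalised
    [(1 - v)^(N - i) v^i], with [i / N] close to [v0], are Bernstein-type densities concentrating at
    any prescribed point [v0]. Those at [v0 = 1] control the coefficient sum, those at arbitrary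
    [v0] give the bound on [|f|]. Second, the integral is an improper Riemann integral whose weight
    may blow up at the ends; in the angle [th] with [x = cos (2 th)] it becomes a proper integral of
    a continuous function.

    As for the constant, the mass inequality costs a factor 4 and the estimate of the tail a factor
    2, which gives [Gamma (al + 2)^2 <= 8 X^(al + 1)] with [X = (r / 2) k^2 (al + be + 2) (al + 2)].
    The square appears because [K] is governed by two beta integrals, each compared directly with
    [Gamma (al + 2)], without Stirling's formula. Since [(4 e^(1/12))^2 > 16], the 8 fits. *)

(* Unlike [rpow], continuous at [x = 0] also for [e = 0]. *)
Definition pw (x e : R) : R :=
  if Rlt_dec 0 x then Rpower x e else if Req_EM_T e 0 then 1 else 0.

Lemma pw_pos x e : 0 < x -> pw x e = Rpower x e.
Proof. intros; unfold pw; destruct (Rlt_dec 0 x); lra. Qed.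

Lemma pw_0 e : e <> 0 -> pw 0 e = 0.
Proof.
  intros; unfold pw; destruct (Rlt_dec 0 0); [lra|].
  destruct (Req_EM_T e 0); lra.
Qed.

Lemma pw_gt0 x e : 0 < x -> 0 < pw x e.
Proof. intros; rewrite pw_pos by easy; apply exp_pos. Qed.

Lemma pw_ge0 x e : 0 <= pw x e.
Proof.
  unfold pw; destruct (Rlt_dec 0 x); [left; apply exp_pos|].
  destruct (Req_EM_T e 0); lra.
Qed.

Lemma is_derive_Rpower x e : 0 < x ->
  is_derive (fun t => Rpower t e) x (e * Rpower x (e - 1)).
Proof.
  intros; apply is_derive_Reals, derivable_pt_lim_power; easy.
Qed.

Lemma is_derive_pw x e : 0 < x -> is_derive (fun t => pw t e) x (e * pw x (e - 1)).
Proof.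
  intros; rewrite pw_pos by easy.
  apply (is_derive_ext_loc (fun t => Rpower t e)); [|now apply is_derive_Rpower].
  exists (mkposreal x H); intros y Hy.
  rewrite pw_pos; [easy|].
  unfold ball in Hy; simpl in Hy; unfold AbsRing_ball, abs, minus, plus, opp in Hy; simpl in Hy.
  apply Rabs_def2 in Hy; lra.
Qed.

(** For [e = 0] the default value 1 makes [pw] constant; for [e > 0] and [x <= 0] the radius
    [eps^(1/e)] works. *)
Lemma continuous_pw e x : 0 <= e -> continuous (fun t => pw t e) x.
Proof.
  intros He.
  destruct (Rlt_dec 0 x) as [Hx|Hx].
  { apply (ex_derive_continuous (K := R_AbsRing) (V := R_NormedModule)).
    eexists; now apply is_derive_pw. }
  destruct (Req_dec e 0) as [E0|E0].
  { subst e. apply continuous_ext with (fun _ => 1); [|apply continuous_const].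
    intros t; unfold pw; destruct (Rlt_dec 0 t).
    - now rewrite Rpower_O.
    - destruct (Req_EM_T 0 0); lra. }
  assert (Hpx : pw x e = 0).
  { unfold pw. destruct (Rlt_dec 0 x); [lra|]. destruct (Req_EM_T e 0); lra. }
  apply continuity_pt_filterlim.
  intros eps Heps.
  exists (Rpower eps (/ e)); split; [apply exp_pos|].
  intros t [_ Ht]. simpl in *. unfold Rdist in *.
  rewrite Hpx, Rminus_0_r, Rabs_pos_eq by apply pw_ge0.
  destruct (Rlt_dec 0 t) as [Ht0|Ht0].
  - rewrite pw_pos by easy.
    replace eps with (Rpower (Rpower eps (/ e)) e).
    + apply Rlt_Rpower_l; [lra|].
      split; [easy|]. apply Rabs_def2 in Ht; lra.
    + rewrite Rpower_mult, Rinv_l, Rpower_1; easy.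
  - unfold pw. destruct (Rlt_dec 0 t); [lra|]. destruct (Req_EM_T e 0); lra.
Qed.

Lemma pw_mult_base x y e : 0 < x -> 0 < y -> pw (x * y) e = pw x e * pw y e.
Proof.
  intros. rewrite !pw_pos by (try apply Rmult_lt_0_compat; easy).
  symmetry; now apply Rpower_mult_distr.
Qed.

Lemma pw_plus x e f : 0 < x -> pw x (e + f) = pw x e * pw x f.
Proof. intros; rewrite !pw_pos by easy; apply Rpower_plus. Qed.

Lemma pw_sqr x e : 0 < x -> pw (x ^ 2) e = pw x (2 * e).
Proof.
  intros. rewrite !pw_pos by (try apply pow_lt; easy).
  rewrite <- Rpower_mult. f_equal.
  rewrite <- (Rpower_pow 2) by easy. f_equal.
Qed.

Lemma pw_succ2 x e : 0 <= x -> 0 <= e -> pw x (e + 2) = x ^ 2 * pw x e.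
Proof.
  intros Hx He. destruct Hx as [Hx|<-].
  - rewrite pw_plus by easy. rewrite (pw_pos x 2) by easy.
    replace (Rpower x 2) with (x ^ 2); [ring|].
    rewrite <- (Rpower_pow 2) by easy. f_equal.
  - rewrite pw_0 by lra. ring.
Qed.

Lemma pw_incr x y e : 0 <= e -> 0 < x <= y -> pw x e <= pw y e.
Proof.
  intros He Hxy. rewrite !pw_pos by lra. apply Rle_Rpower_l; lra.
Qed.

(** The derivative is asked for in the open interval only, because the antiderivatives used below
    are powers of [sin] and [cos], and [is_derive_pw] needs a positive base. By the mean value
    theorem, the integral minus [F] is constant. *)
Lemma RInt_FTC (f F : R -> R) a b : a <= b ->
  (forall x, continuous f x) -> (forall x, a <= x <= b -> continuous F x) ->
  (forall x, a < x < b -> is_derive F x (f x)) -> RInt f a b = F b - F a.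
Proof.
  intros Hab Hf HF HD.
  assert (Hex : forall u v, ex_RInt f u v).
  { intros; apply (ex_RInt_continuous (V := R_CompleteNormedModule)); intros; apply Hf. }
  assert (HI : forall x, is_derive (fun t => RInt f a t) x (f x)).
  { intros x. apply (is_derive_RInt f _ a x); [|apply Hf].
    apply filter_forall; intros y. apply (RInt_correct (V := R_CompleteNormedModule)), Hex. }
  destruct (MVT_gen (fun t => RInt f a t - F t) a b (fun _ => 0)) as [c [_ Hc]].
  - rewrite Rmin_left, Rmax_right by easy. intros x Hx.
    evar_last. apply (is_derive_minus (K := R_AbsRing) (V := R_NormedModule)); [apply HI|apply HD, Hx].
    unfold minus, plus, opp; simpl; ring.
  - rewrite Rmin_left, Rmax_right by easy. intros x Hx.
    apply continuity_pt_filterlim.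
    apply (continuous_minus (K := R_AbsRing) (V := R_NormedModule) (fun t => RInt f a t) F); [|apply HF, Hx].
    apply (ex_derive_continuous (K := R_AbsRing) (V := R_NormedModule)). eexists; apply HI.
  - rewrite RInt_point in Hc. unfold zero in Hc; simpl in Hc. lra.
Qed.

(** Continuity on the whole line keeps integrability free of side conditions; functions given on [I]
    are extended by [clamp]. *)
Definition cont (g : R -> R) := forall x, continuous g x.

Lemma cont_const c : cont (fun _ => c).
Proof. intros x; apply continuous_const. Qed.
Lemma cont_id : cont (fun x => x).
Proof. intros x; apply continuous_id. Qed.
Lemma cont_plus f g : cont f -> cont g -> cont (fun x => f x + g x).
Proof. intros Hf Hg x; now apply (continuous_plus (K := R_AbsRing) (V := R_NormedModule) f g). Qed.
Lemma cont_minus f g : cont f -> cont g -> cont (fun x => f x - g x).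
Proof. intros Hf Hg x; now apply (continuous_minus (K := R_AbsRing) (V := R_NormedModule) f g). Qed.
Lemma cont_opp f : cont f -> cont (fun x => - f x).
Proof. intros Hf x; now apply (continuous_opp (K := R_AbsRing) (V := R_NormedModule) f). Qed.
Lemma cont_mult f g : cont f -> cont g -> cont (fun x => f x * g x).
Proof. intros Hf Hg x; now apply (continuous_mult (K := R_AbsRing) f g). Qed.
Lemma cont_div f c : cont f -> cont (fun x => f x / c).
Proof. intros; apply cont_mult; [easy|apply cont_const]. Qed.
Lemma cont_pow f n : cont f -> cont (fun x => f x ^ n).
Proof.
  intros Hf; induction n; simpl; [apply cont_const|now apply cont_mult].
Qed.
Lemma cont_comp f g : cont f -> cont g -> cont (fun x => f (g x)).
Proof. intros Hf Hg x; now apply (continuous_comp g f). Qed.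
Lemma cont_abs f : cont f -> cont (fun x => Rabs (f x)).
Proof. intros Hf x. apply (continuous_comp f Rabs); [easy|apply continuous_Rabs]. Qed.
Lemma cont_sum (f : nat -> R -> R) n : (forall i, cont (f i)) -> cont (fun x => sum_f_R0 (fun i => f i x) n).
Proof.
  intros Hf; induction n; simpl; [apply Hf|now apply cont_plus].
Qed.
Lemma cont_sin : cont sin.
Proof. intros x; apply continuous_sin. Qed.
Lemma cont_cos : cont cos.
Proof. intros x; apply continuous_cos. Qed.
Lemma cont_pw e : 0 <= e -> cont (fun x => pw x e).
Proof. intros He x; now apply continuous_pw. Qed.

#[export] Hint Resolve cont_const cont_id cont_plus cont_minus cont_opp cont_mult cont_div cont_pow
  cont_abs cont_sum cont_sin cont_cos : cont.

Lemma cont_ex_RInt f a b : cont f -> ex_RInt f a b.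
Proof. intros Hf; apply (ex_RInt_continuous (V := R_CompleteNormedModule)); intros; apply Hf. Qed.

(** The measure [(1 - v)^al v^be dv] pulled back along [v = cos^2 th]; the Jacobian
    [2 sin th cos th] is included, whence the exponents [2 al + 1] and [2 be + 1]. *)
Definition jw (al be th : R) : R := 2 * pw (sin th) (2 * al + 1) * pw (cos th) (2 * be + 1).

(* With [v = (1 + x) / 2 = cos^2 th] the weight becomes continuous because [al, be >= -1/2]. *)
Definition J (al be : R) (g : R -> R) : R :=
  RInt (fun th => g (cos th ^ 2) * jw al be th) 0 (PI / 2).

(** Kept separate from [be <= al], since the parameters [(al, 0)] also occur, possibly with
    [al < 0]. *)
Definition adm (al be : R) := -1/2 <= al /\ -1/2 <= be.

Lemma cont_jw al be : adm al be -> cont (jw al be).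
Proof.
  intros [Ha Hb]; unfold jw.
  apply cont_mult; [apply cont_mult; auto with cont|].
  - apply (cont_comp (fun x => pw x _) sin); auto with cont. apply cont_pw; lra.
  - apply (cont_comp (fun x => pw x _) cos); auto with cont. apply cont_pw; lra.
Qed.

Lemma cont_J_integrand al be g : adm al be -> cont g -> cont (fun th => g (cos th ^ 2) * jw al be th).
Proof.
  intros H Hg; apply cont_mult; [|now apply cont_jw].
  apply (cont_comp g (fun th => cos th ^ 2)); auto with cont.
Qed.

Lemma jw_ge0 al be th : 0 <= jw al be th.
Proof.
  unfold jw. apply Rmult_le_pos; [apply Rmult_le_pos; [lra|]|]; apply pw_ge0.
Qed.

Lemma PI2_pos : 0 < PI / 2.
Proof. pose proof PI_RGT_0; lra. Qed.

Lemma sin_cos_pos th : 0 < th < PI / 2 -> 0 < sin th /\ 0 < cos th.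
Proof.
  intros; split; [apply sin_gt_0|apply cos_gt_0]; pose proof PI_RGT_0; lra.
Qed.

Lemma jw_gt0 al be th : 0 < th < PI / 2 -> 0 < jw al be th.
Proof.
  intros H; destruct (sin_cos_pos th H). unfold jw.
  apply Rmult_lt_0_compat; [apply Rmult_lt_0_compat; [lra|]|]; now apply pw_gt0.
Qed.

Lemma cos2_bounds th : 0 <= cos th ^ 2 <= 1.
Proof. pose proof (COS_bound th); nra. Qed.

Lemma J_le al be f g : adm al be -> cont f -> cont g ->
  (forall v, 0 <= v <= 1 -> f v <= g v) -> J al be f <= J al be g.
Proof.
  intros H Hf Hg Hle; unfold J. pose proof PI2_pos.
  apply RInt_le; [lra| | |]; try (apply cont_ex_RInt; now apply cont_J_integrand).
  intros x Hx. apply Rmult_le_compat_r; [apply jw_ge0|]. apply Hle, cos2_bounds.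
Qed.

Lemma J_ext al be f g : (forall v, 0 <= v <= 1 -> f v = g v) -> J al be f = J al be g.
Proof.
  intros H; unfold J; apply RInt_ext; intros; f_equal; apply H, cos2_bounds.
Qed.

Lemma J_plus al be f g : adm al be -> cont f -> cont g ->
  J al be (fun v => f v + g v) = J al be f + J al be g.
Proof.
  intros H Hf Hg; unfold J.
  rewrite <- (RInt_plus (V := R_CompleteNormedModule)); try (apply cont_ex_RInt; now apply cont_J_integrand).
  apply RInt_ext; intros; unfold plus; simpl; ring.
Qed.

Lemma J_scal al be c f : adm al be -> cont f -> J al be (fun v => c * f v) = c * J al be f.
Proof.
  intros H Hf; unfold J.
  rewrite <- (RInt_scal (V := R_CompleteNormedModule)); try (apply cont_ex_RInt; now apply cont_J_integrand).
  apply RInt_ext; intros; unfold scal; simpl; unfold mult; simpl; ring.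
Qed.

Lemma J1_pos al be : adm al be -> 0 < J al be (fun _ => 1).
Proof.
  intros H; unfold J; apply RInt_gt_0; [apply PI2_pos| |].
  - intros; rewrite Rmult_1_l; now apply jw_gt0.
  - intros; apply (cont_J_integrand al be (fun _ => 1)); auto with cont.
Qed.

(** The expectation under the normalised weight; dividing by the total mass absorbs [cw] and the
    powers of 2 from the change of variables. *)
Definition E (al be : R) (g : R -> R) : R := J al be g / J al be (fun _ => 1).

Lemma E_ext al be f g : (forall v, 0 <= v <= 1 -> f v = g v) -> E al be f = E al be g.
Proof. intros H; unfold E; now rewrite (J_ext al be f g). Qed.

Lemma E_plus al be f g : adm al be -> cont f -> cont g ->
  E al be (fun v => f v + g v) = E al be f + E al be g.
Proof. intros; unfold E; rewrite J_plus by easy; unfold Rdiv; ring. Qed.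

Lemma E_scal al be c f : adm al be -> cont f -> E al be (fun v => c * f v) = c * E al be f.
Proof. intros; unfold E; rewrite J_scal by easy; unfold Rdiv; ring. Qed.

Lemma E_opp al be f : adm al be -> cont f -> E al be (fun v => - f v) = - E al be f.
Proof.
  intros. rewrite (E_ext al be _ (fun v => -1 * f v)) by (intros; ring).
  rewrite E_scal by easy; ring.
Qed.

Lemma E_minus al be f g : adm al be -> cont f -> cont g ->
  E al be (fun v => f v - g v) = E al be f - E al be g.
Proof.
  intros. unfold Rminus. rewrite (E_plus al be f (fun v => - g v)) by auto with cont.
  now rewrite E_opp.
Qed.

Lemma E_le al be f g : adm al be -> cont f -> cont g ->
  (forall v, 0 <= v <= 1 -> f v <= g v) -> E al be f <= E al be g.
Proof.
  intros H ? ? ?; unfold E. apply Rmult_le_compat_r; [|now apply J_le].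
  left; apply Rinv_0_lt_compat. now apply J1_pos.
Qed.

Lemma E_const al be c : adm al be -> E al be (fun _ => c) = c.
Proof.
  intros. rewrite (E_ext al be _ (fun v => c * 1)) by (intros; ring).
  rewrite E_scal by auto with cont. unfold E. field. apply Rgt_not_eq. now apply J1_pos.
Qed.

Lemma E_ge0 al be f : adm al be -> cont f -> (forall v, 0 <= v <= 1 -> 0 <= f v) -> 0 <= E al be f.
Proof.
  intros. rewrite <- (E_const al be 0) by easy. apply E_le; auto with cont.
Qed.

Lemma E_sum al be (f : nat -> R -> R) n : adm al be -> (forall i, cont (f i)) ->
  E al be (fun v => sum_f_R0 (fun i => f i v) n) = sum_f_R0 (fun i => E al be (f i)) n.
Proof.
  intros H Hf; induction n; simpl.
  - apply E_ext; easy.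
  - rewrite E_plus; auto with cont. now rewrite IHn.
Qed.

Lemma E_Rabs al be f : adm al be -> cont f -> Rabs (E al be f) <= E al be (fun v => Rabs (f v)).
Proof.
  intros H Hf. apply Rabs_le; split.
  - rewrite <- E_opp by auto with cont. apply E_le; auto with cont.
    intros; pose proof (Rle_abs (- f v)); rewrite Rabs_Ropp in *; lra.
  - apply E_le; auto with cont. intros; apply Rle_abs.
Qed.

(** Serves twice: its integrals are the beta moments that determine all Jacobi coefficients, and,
    normalised, it is the concentrating kernel. *)
Definition mom (i j : nat) (v : R) : R := (1 - v) ^ i * v ^ j.

Lemma cont_mom i j : cont (mom i j).
Proof. unfold mom; auto 8 with cont. Qed.
#[export] Hint Resolve cont_mom : cont.

Definition m (al be : R) (i j : nat) : R := J al be (mom i j).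

Lemma m_split al be i j : adm al be -> m al be (S i) j + m al be i (S j) = m al be i j.
Proof.
  intros. unfold m. rewrite <- J_plus by auto with cont.
  apply J_ext; intros; unfold mom; simpl; ring.
Qed.

Lemma mom_jw al be i j th : adm al be -> 0 <= th <= PI / 2 ->
  mom i j (cos th ^ 2) * jw al be th =
  2 * pw (sin th) (2 * (al + INR i) + 1) * pw (cos th) (2 * (be + INR j) + 1).
Proof.
  intros [Ha Hb] Hth.
  assert (Hs : 0 <= sin th) by (apply sin_ge_0; pose proof PI_RGT_0; lra).
  assert (Hc : 0 <= cos th) by (apply cos_ge_0; lra).
  unfold mom, jw.
  assert (HS : forall i e x, 0 <= x -> -1/2 <= e -> pw x (2 * (e + INR i) + 1) = (x ^ 2) ^ i * pw x (2 * e + 1)).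
  { clear. intros i e x Hx He. induction i.
    - simpl. rewrite Rplus_0_r. ring.
    - rewrite S_INR. replace (2 * (e + (INR i + 1)) + 1) with (2 * (e + INR i) + 1 + 2) by ring.
      rewrite pw_succ2; [|easy|pose proof (pos_INR i); lra].
      rewrite IHi. simpl. ring. }
  rewrite !HS by lra.
  replace (1 - cos th ^ 2) with (sin th ^ 2).
  - ring.
  - pose proof (sin2_cos2 th). unfold Rsqr in *. lra.
Qed.

(* Integration by parts: the boundary term [sin^(2 al + 2 i + 2) cos^(2 be + 2 j + 2)] vanishes at both ends. *)
Lemma m_parts al be i j : adm al be ->
  (al + INR i + 1) * m al be i (S j) = (be + INR j + 1) * m al be (S i) j.
Proof.
  intros H. pose proof PI2_pos as HP. pose proof H as [Ha Hb].
  pose proof (pos_INR i) as Hi; pose proof (pos_INR j) as Hj.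
  set (F := fun th => pw (sin th) (2 * (al + INR i) + 2) * pw (cos th) (2 * (be + INR j) + 2)).
  set (f := fun th => (al + INR i + 1) * (mom i (S j) (cos th ^ 2) * jw al be th)
                    - (be + INR j + 1) * (mom (S i) j (cos th ^ 2) * jw al be th)).
  assert (HF : RInt f 0 (PI / 2) = F (PI / 2) - F 0).
  { apply RInt_FTC; [lra| | |].
    - apply cont_minus; apply cont_mult; auto with cont; apply cont_J_integrand; auto with cont.
    - intros x _; unfold F. apply cont_mult.
      + apply (cont_comp (fun x => pw x _) sin); auto with cont. apply cont_pw; lra.
      + apply (cont_comp (fun x => pw x _) cos); auto with cont. apply cont_pw; lra.
    - intros x Hx. destruct (sin_cos_pos x Hx) as [Hs Hc].
      unfold f, F. rewrite !mom_jw by (easy || lra). rewrite !S_INR.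
      evar_last.
      + apply (is_derive_mult (K := R_AbsRing) (fun t => pw (sin t) _) (fun t => pw (cos t) _)).
        * apply (is_derive_comp (fun t => pw t _) sin); [now apply is_derive_pw|apply is_derive_sin].
        * apply (is_derive_comp (fun t => pw t _) cos); [now apply is_derive_pw|apply is_derive_cos].
        * intros; apply Rmult_comm.
      + unfold plus, mult, scal; simpl; unfold mult; simpl.
        replace (2 * (al + INR i) + 2 - 1) with (2 * (al + INR i) + 1) by ring.
        replace (2 * (be + INR j) + 2 - 1) with (2 * (be + INR j) + 1) by ring.
        replace (2 * (be + (INR j + 1)) + 1) with (2 * (be + INR j) + 2 + 1) by ring.
        replace (2 * (al + (INR i + 1)) + 1) with (2 * (al + INR i) + 2 + 1) by ring.
        rewrite (pw_plus (sin x) (2 * (al + INR i) + 2)), (pw_plus (cos x) (2 * (be + INR j) + 2)) by easy.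
        rewrite (pw_pos (sin x) 1), (pw_pos (cos x) 1), !Rpower_1 by easy. ring. }
  assert (E1 : RInt f 0 (PI / 2) = (al + INR i + 1) * m al be i (S j) - (be + INR j + 1) * m al be (S i) j).
  { unfold m. rewrite <- !J_scal by auto with cont. unfold J.
    rewrite <- (RInt_minus (V := R_CompleteNormedModule)).
    - apply RInt_ext; intros; unfold f, minus, plus, opp; simpl; ring.
    - apply cont_ex_RInt, (cont_J_integrand al be (fun v => (al + INR i + 1) * mom i (S j) v)); auto with cont.
    - apply cont_ex_RInt, (cont_J_integrand al be (fun v => (be + INR j + 1) * mom (S i) j v)); auto with cont. }
  assert (E2 : F (PI / 2) = 0) by (unfold F; rewrite cos_PI2, (pw_0 (2 * (be + INR j) + 2)) by lra; ring).
  assert (E3 : F 0 = 0) by (unfold F; rewrite sin_0, (pw_0 (2 * (al + INR i) + 2)) by lra; ring).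
  lra.
Qed.

(** [m_split] and [m_parts] form a linear system for the two neighbours of [m al be i j], with
    determinant [al + be + i + j + 2]; this lemma and the next solve it. *)
Lemma m_right al be i j : adm al be ->
  m al be i (S j) = (be + INR j + 1) / (al + be + INR i + INR j + 2) * m al be i j.
Proof.
  intros H. pose proof (m_parts al be i j H) as Hp. pose proof (m_split al be i j H) as Hs.
  destruct H. pose proof (pos_INR i); pose proof (pos_INR j).
  apply Rmult_eq_reg_l with (al + be + INR i + INR j + 2); [|lra].
  transitivity ((al + INR i + 1) * m al be i (S j) + (be + INR j + 1) * m al be i (S j)); [ring|].
  rewrite Hp, <- Hs. field. lra.
Qed.

Lemma m_left al be i j : adm al be ->
  m al be (S i) j = (al + INR i + 1) / (al + be + INR i + INR j + 2) * m al be i j.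
Proof.
  intros H. pose proof (m_right al be i j H) as Hr. pose proof (m_split al be i j H) as Hs.
  destruct H. pose proof (pos_INR i); pose proof (pos_INR j).
  replace (m al be (S i) j) with (m al be i j - m al be i (S j)) by lra.
  rewrite Hr. field. lra.
Qed.

Lemma m00 al be : m al be 0 0 = J al be (fun _ => 1).
Proof. apply J_ext; intros; unfold mom; simpl; ring. Qed.

Fixpoint poch (a : R) (n : nat) : R :=
  match n with O => 1 | S k => poch a k * (a + INR k) end.

Lemma poch_pos a n : 0 < a -> 0 < poch a n.
Proof.
  intros; induction n; simpl; [lra|]. apply Rmult_lt_0_compat; [easy|]. pose proof (pos_INR n); lra.
Qed.

(** The ratio [B(al + i + 1, be + j + 1) / B(al + 1, be + 1)], written with rising factorials so
    that no Gamma function enters before the final estimates. *)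
Lemma m_poch al be i j : adm al be ->
  m al be i j = poch (al + 1) i * poch (be + 1) j / poch (al + be + 2) (i + j) * m al be 0 0.
Proof.
  intros H. pose proof H as [Ha Hb].
  assert (H0 : forall j, m al be 0 j = poch (be + 1) j / poch (al + be + 2) j * m al be 0 0).
  { clear j; intros j. induction j as [|j IH]; [simpl; field|].
    rewrite m_right, IH by easy. simpl. pose proof (poch_pos (al + be + 2) j).
    pose proof (pos_INR j). simpl. field. split; [lra|]. apply Rgt_not_eq, H0; lra. }
  induction i as [|i IH]; [rewrite H0; simpl; field; apply Rgt_not_eq, poch_pos; lra|].
  rewrite m_left, IH by easy. simpl. rewrite plus_INR.
  pose proof (pos_INR i); pose proof (pos_INR j).
  field; repeat split; try lra; apply Rgt_not_eq, poch_pos; lra.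
Qed.

Lemma m_pos al be i j : adm al be -> 0 < m al be i j.
Proof.
  intros H; rewrite m_poch by easy. rewrite m00. pose proof (J1_pos al be H). destruct H.
  apply Rmult_lt_0_compat; [|easy].
  apply Rdiv_lt_0_compat; [apply Rmult_lt_0_compat|]; apply poch_pos; lra.
Qed.

Lemma E_mom al be i j : adm al be ->
  E al be (mom i j) = poch (al + 1) i * poch (be + 1) j / poch (al + be + 2) (i + j).
Proof.
  intros H; unfold E. change (J al be (mom i j)) with (m al be i j).
  rewrite m_poch, m00 by easy.
  pose proof (J1_pos al be H) as HJ. pose proof (poch_pos (al + be + 2) (i + j)) as HP.
  destruct H. generalize dependent (J al be (fun _ => 1)). intros j1 Hj.
  field. split; [apply Rgt_not_eq, HP|]; lra.
Qed.

Lemma E_mom_pos al be i j : adm al be -> 0 < E al be (mom i j).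
Proof.
  intros H; unfold E. apply Rdiv_lt_0_compat; [exact (m_pos al be i j H)|exact (J1_pos al be H)].
Qed.

(** * Jacobi polynomials against powers of [v] *)

Lemma poch_S_l a n : poch a (S n) = a * poch (a + 1) n.
Proof.
  induction n; [simpl; ring|].
  change (poch a (S (S n))) with (poch a (S n) * (a + INR (S n))).
  rewrite IHn, S_INR. simpl. ring.
Qed.

Lemma poch_add a n k : poch a (n + k) = poch a n * poch (a + INR n) k.
Proof.
  induction k; [rewrite Nat.add_0_r; simpl; ring|].
  rewrite Nat.add_succ_r. simpl. rewrite IHk, plus_INR. ring.
Qed.

(** The falling factorial supplies the top [l] factors of the product of [b + 1, ..., b + n]. *)
Lemma falling_poch b n l : (l <= n)%nat ->
  falling (INR n + b) l * poch (b + 1) (n - l) = poch (b + 1) n.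
Proof.
  induction l; intros Hl; [rewrite Nat.sub_0_r; simpl; ring|].
  rewrite <- IHl by lia. replace (n - l)%nat with (S (n - S l)) by lia.
  simpl. rewrite minus_INR, S_INR by lia. ring.
Qed.

Definition jc (al be : R) (n l : nat) : R :=
  gbinom (INR n + al) l * gbinom (INR n + be) (n - l).

(* The Jacobi polynomial in the variable [v = (1 + x) / 2]. *)
Definition jy (al be : R) (n : nat) (v : R) : R :=
  sum_f_R0 (fun l => jc al be n l * (v - 1) ^ (n - l) * v ^ l) n.

Lemma jacobiP_jy al be n v : jacobiP al be n (2 * v - 1) = jy al be n v.
Proof.
  unfold jacobiP, jy, jc. apply sum_eq; intros.
  replace ((2 * v - 1 - 1) / 2) with (v - 1) by field.
  now replace ((2 * v - 1 + 1) / 2) with v by field.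
Qed.

Lemma cont_jy al be n : cont (jy al be n).
Proof. unfold jy. apply cont_sum; intros. auto 8 with cont. Qed.
#[export] Hint Resolve cont_jy : cont.

Lemma jc_poch al be n l : adm al be -> (l <= n)%nat ->
  jc al be n l = poch (al + 1) n * poch (be + 1) n /
    (INR (fact l) * INR (fact (n - l)) * poch (al + 1) (n - l) * poch (be + 1) l).
Proof.
  intros [Ha Hb] Hl. unfold jc, gbinom.
  rewrite <- (falling_poch al n l) by easy.
  rewrite <- (falling_poch be n (n - l)) by lia.
  replace (n - (n - l))%nat with l by lia.
  pose proof (INR_fact_neq_0 l); pose proof (INR_fact_neq_0 (n - l)).
  pose proof (poch_pos (al + 1) (n - l)); pose proof (poch_pos (be + 1) l).
  field; repeat split; try easy; apply Rgt_not_eq; [apply H2|apply H1]; lra.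
Qed.

Lemma jc_pos al be n l : adm al be -> (l <= n)%nat -> 0 < jc al be n l.
Proof.
  intros H Hl. rewrite jc_poch by easy. destruct H.
  apply Rdiv_lt_0_compat; repeat apply Rmult_lt_0_compat; try apply INR_fact_lt_0; apply poch_pos; lra.
Qed.

Lemma gbinom_0 b : gbinom b 0 = 1.
Proof. unfold gbinom; simpl; field. Qed.

Lemma jy_1 al be n : jy al be n 1 = gbinom (INR n + al) n.
Proof.
  unfold jy. destruct n.
  - simpl. unfold jc, gbinom; simpl. field.
  - rewrite tech5, (sum_eq _ (fun _ => 0)).
    + rewrite sum_cte. unfold jc. rewrite Nat.sub_diag, gbinom_0, pow1, pow_O. ring.
    + intros i Hi. rewrite Rminus_diag, pow_i by lia. ring.
Qed.

Lemma jy_0 al be n : jy al be n 0 = gbinom (INR n + be) n * (-1) ^ n.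
Proof.
  unfold jy. destruct n.
  - simpl. unfold jc, gbinom; simpl. field.
  - rewrite decomp_sum by lia. rewrite (sum_eq _ (fun _ => 0)).
    + rewrite sum_cte. unfold jc. rewrite Nat.sub_0_r.
      rewrite gbinom_0, pow_O. replace (0 - 1) with (-1) by ring. ring.
    + intros i Hi. rewrite (pow_i (S i)) by lia. ring.
Qed.

Lemma gbinom_poch b n : gbinom (INR n + b) n = poch (b + 1) n / INR (fact n).
Proof.
  unfold gbinom. rewrite <- (falling_poch b n n), Nat.sub_diag by lia. simpl. field. apply INR_fact_neq_0.
Qed.

Lemma jy_1_pos al be n : adm al be -> 0 < jy al be n 1.
Proof.
  intros [Ha Hb]. rewrite jy_1, gbinom_poch.
  apply Rdiv_lt_0_compat; [apply poch_pos; lra|apply INR_fact_lt_0].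
Qed.

(** Up to sign, the two endpoint values differ only by [poch (be + 1) n] against [poch (al + 1) n],
    so [be <= al] decides which is larger. *)
Lemma jy_01 al be n : adm al be -> be <= al -> Rabs (jy al be n 0) <= jy al be n 1.
Proof.
  intros [Ha Hb] H. rewrite jy_0, jy_1, Rabs_mult, pow_1_abs, Rmult_1_r, !gbinom_poch.
  rewrite Rabs_pos_eq.
  2:{ left; apply Rdiv_lt_0_compat; [apply poch_pos; lra|apply INR_fact_lt_0]. }
  apply Rmult_le_compat_r; [left; apply Rinv_0_lt_compat, INR_fact_lt_0|].
  induction n; simpl; [lra|].
  apply Rmult_le_compat; [left; apply poch_pos; lra| |easy|lra].
  pose proof (pos_INR n); lra.
Qed.

(** The [n]-th forward difference of [q] at [b] with step 1, as an explicit alternating sum so that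
    Jacobi moments can be matched with it termwise. *)
Definition fdiff (n : nat) (q : R -> R) (b : R) : R :=
  sum_f_R0 (fun l => Binomial.C n l * (-1) ^ (n - l) * q (b + INR l)) n.

Lemma fdiff_S n q b : fdiff (S n) q b = fdiff n q (b + 1) - fdiff n q b.
Proof.
  unfold fdiff. destruct n.
  - unfold Binomial.C. simpl.
    replace (b + 1 + 0) with (b + 1) by ring. field.
  - rewrite (decomp_sum _ (S (S n))) by lia. simpl Init.Nat.pred.
    rewrite tech5.
    rewrite (tech5 _ n), (decomp_sum (fun l => _ * _ * q (b + INR l)) (S n)) by lia.
    simpl Init.Nat.pred.
    (* Pascal's rule for the interior terms, the outer ones having been split off. *)
    rewrite (sum_eq (fun i => Binomial.C (S (S n)) (S i) * (-1) ^ (S (S n) - S i) * q (b + INR (S i)))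
      (fun i => Binomial.C (S n) i * (-1) ^ (S n - i) * q (b + 1 + INR i)
        - Binomial.C (S n) (S i) * (-1) ^ (S n - S i) * q (b + INR (S i)))).
    + rewrite minus_sum. rewrite !Nat.sub_diag.
      assert (HC0 : forall k, Binomial.C k 0 = 1).
      { intros k. unfold Binomial.C. rewrite Nat.sub_0_r. simpl. field. apply INR_fact_neq_0. }
      assert (HCn : forall k, Binomial.C k k = 1).
      { intros k. rewrite pascal_step1, Nat.sub_diag by lia. apply HC0. }
      rewrite !HC0, !HCn, !Nat.sub_0_r.
      replace (b + 1 + INR (S n)) with (b + INR (S (S n))) by (rewrite (S_INR (S n)); ring).
      simpl ((-1) ^ S (S n)). simpl ((-1) ^ S n). simpl ((-1) ^ 0). ring.
    + intros i Hi. rewrite <- (pascal (S n) i) by lia.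
      replace (b + 1 + INR i) with (b + INR (S i)) by (rewrite S_INR; ring).
      replace (S (S n) - S i)%nat with (S n - i)%nat by lia.
      replace (S n - i)%nat with (S (S n - S i)) by lia. simpl. ring.
Qed.

Lemma fdiff_ext n q q' b : (forall x, q x = q' x) -> fdiff n q b = fdiff n q' b.
Proof. intros H; unfold fdiff; apply sum_eq; intros; now rewrite H. Qed.

Lemma fdiff_scal n c q b : fdiff n (fun x => c * q x) b = c * fdiff n q b.
Proof. unfold fdiff; rewrite scal_sum; apply sum_eq; intros; ring. Qed.

(** Rising factorials are to differences what powers are to derivatives: one difference lowers the
    degree by one, here with a shift of the base point. Iterating it gives both [fdiff_poch_0] and
    [fdiff_poch]. *)
Lemma poch_diff x N : poch (x + 1) (S N) - poch x (S N) = INR (S N) * poch (x + 1) N.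
Proof.
  rewrite (poch_S_l x), S_INR. simpl. ring.
Qed.

Lemma fdiff_fdiff n q b : fdiff (S n) q b = fdiff n (fun x => q (x + 1) - q x) b.
Proof.
  rewrite fdiff_S. unfold fdiff. rewrite <- minus_sum. apply sum_eq; intros.
  replace (b + 1 + INR i) with (b + INR i + 1) by ring. ring.
Qed.

Lemma fdiff_shift n q b : fdiff n (fun x => q (x + 1)) b = fdiff n q (b + 1).
Proof.
  unfold fdiff. apply sum_eq; intros. now replace (b + 1 + INR i) with (b + INR i + 1) by ring.
Qed.

Lemma fdiff_poch_0 n N b : (N < n)%nat -> fdiff n (fun x => poch x N) b = 0.
Proof.
  revert N b; induction n; intros N b HN; [lia|].
  rewrite fdiff_fdiff. destruct N.
  - unfold fdiff. rewrite (sum_eq _ (fun _ => 0)); [rewrite sum_cte; ring|]. intros; simpl; ring.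
  - rewrite (fdiff_ext _ _ (fun x => INR (S N) * poch (x + 1) N)) by (intros; apply poch_diff).
    rewrite (fdiff_scal n (INR (S N)) (fun x => poch (x + 1) N)).
    rewrite (fdiff_shift n (fun x => poch x N)). rewrite IHn by lia. ring.
Qed.

Lemma fdiff_poch n N b : (n <= N)%nat ->
  INR (fact (N - n)) * fdiff n (fun x => poch x N) b = INR (fact N) * poch (b + INR n) (N - n).
Proof.
  revert N b; induction n; intros N b HN.
  - rewrite Nat.sub_0_r. unfold fdiff, Binomial.C; simpl. rewrite Rplus_0_r.
    field.
  - rewrite fdiff_fdiff. destruct N; [lia|].
    rewrite (fdiff_ext _ _ (fun x => INR (S N) * poch (x + 1) N)) by (intros; apply poch_diff).
    rewrite (fdiff_scal n (INR (S N)) (fun x => poch (x + 1) N)).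
    rewrite (fdiff_shift n (fun x => poch x N)).
    change (S N - S n)%nat with (N - n)%nat.
    transitivity (INR (S N) * (INR (fact (N - n)) * fdiff n (fun x => poch x N) (b + 1))); [ring|].
    rewrite IHn by lia.
    change (fact (S N)) with (S N * fact N)%nat. rewrite mult_INR, (S_INR n).
    replace (b + 1 + INR n) with (b + (INR n + 1)) by ring. ring.
Qed.

(* Each moment is a quotient of rising factorials, and their [l]-dependence cancels against the coefficients
   of [jy] up to a binomial coefficient and [poch (be + 1 + l) N]. *)
Lemma E_jy_pow_fdiff al be n N : adm al be ->
  E al be (fun v => jy al be n v * v ^ N) =
  poch (al + 1) n * poch (be + 1) n / (INR (fact n) * poch (al + be + 2) (n + N))
    * fdiff n (fun x => poch x N) (be + 1).
Proof.
  intros H.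
  rewrite (E_ext al be _ (fun v => sum_f_R0 (fun l => (jc al be n l * (-1) ^ (n - l)) * mom (n - l) (l + N) v) n)).
  2:{ intros v _. unfold jy. rewrite <- (Rmult_comm (v ^ N)), scal_sum. apply sum_eq; intros l Hl.
      unfold mom. rewrite pow_add. replace (v - 1) with (-1 * (1 - v)) by ring. rewrite Rpow_mult_distr. ring. }
  rewrite (E_sum al be (fun l v => (jc al be n l * (-1) ^ (n - l)) * mom (n - l) (l + N) v)) by auto with cont.
  unfold fdiff. rewrite scal_sum. apply sum_eq; intros l Hl.
  rewrite E_scal, E_mom, jc_poch by auto with cont.
  replace (n - l + (l + N))%nat with (n + N)%nat by lia.
  rewrite (poch_add (be + 1) l N). unfold Binomial.C. destruct H as [Ha Hb].
  pose proof (INR_fact_neq_0 l); pose proof (INR_fact_neq_0 (n - l)); pose proof (INR_fact_neq_0 n).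
  assert (poch (al + be + 2) (n + N) <> 0) by (apply Rgt_not_eq, poch_pos; lra).
  assert (poch (be + 1) l <> 0) by (apply Rgt_not_eq, poch_pos; lra).
  assert (poch (al + 1) (n - l) <> 0) by (apply Rgt_not_eq, poch_pos; lra).
  field. repeat split; easy.
Qed.

Lemma E_jy_pow_0 al be n N : adm al be -> (N < n)%nat -> E al be (fun v => jy al be n v * v ^ N) = 0.
Proof. intros. rewrite E_jy_pow_fdiff, fdiff_poch_0 by easy. ring. Qed.

Lemma E_jy_pow al be n N : adm al be -> (n <= N)%nat ->
  E al be (fun v => jy al be n v * v ^ N) =
  poch (al + 1) n * poch (be + 1) n * INR (fact N) * poch (be + 1 + INR n) (N - n)
   / (INR (fact n) * poch (al + be + 2) (n + N) * INR (fact (N - n))).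
Proof.
  intros H Hn. rewrite E_jy_pow_fdiff by easy.
  pose proof (fdiff_poch n N (be + 1) Hn) as HF.
  pose proof (INR_fact_neq_0 n); pose proof (INR_fact_neq_0 (N - n)).
  assert (poch (al + be + 2) (n + N) <> 0) by (destruct H; apply Rgt_not_eq, poch_pos; lra).
  replace (fdiff n (fun x => poch x N) (be + 1)) with (INR (fact N) * poch (be + 1 + INR n) (N - n) / INR (fact (N - n))).
  - field. repeat split; easy.
  - rewrite <- HF. field. easy.
Qed.

Lemma E_jy_pow_ge0 al be n N : adm al be -> 0 <= E al be (fun v => jy al be n v * v ^ N).
Proof.
  intros H. destruct (Nat.le_gt_cases n N) as [Hn|Hn]; [|rewrite E_jy_pow_0 by easy; lra].
  rewrite E_jy_pow by easy. destruct H. left. pose proof (pos_INR n).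
  apply Rdiv_lt_0_compat; repeat apply Rmult_lt_0_compat; try apply INR_fact_lt_0; apply poch_pos; lra.
Qed.

(** * Orthonormal expansions and the Christoffel-Darboux kernel at the endpoint *)

Lemma gbinom_S a k : (INR k + 1) * gbinom a (S k) = (a - INR k) * gbinom a k.
Proof.
  unfold gbinom. change (fact (S k)) with (S k * fact k)%nat. rewrite mult_INR, S_INR.
  simpl. pose proof (INR_fact_neq_0 k). pose proof (pos_INR k). field. split; [easy|lra].
Qed.

(** Chu-Vandermonde for real upper entries. In the induction, [n + 1] is split as [l + (n + 1 - l)]
    inside the sum; [gbinom_S] lowers one index in each half, and the two halves recombine with the
    factor [a + b - n]. *)
Lemma vandermonde a b n :
  sum_f_R0 (fun l => gbinom a l * gbinom b (n - l)) n = gbinom (a + b) n.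
Proof.
  induction n; [simpl; rewrite !gbinom_0; ring|].
  apply Rmult_eq_reg_l with (INR n + 1); [|pose proof (pos_INR n); lra].
  rewrite gbinom_S, <- IHn, !scal_sum.
  transitivity (sum_f_R0 (fun l => INR l * gbinom a l * gbinom b (S n - l)) (S n)
     + sum_f_R0 (fun l => gbinom a l * (INR (S n - l) * gbinom b (S n - l))) (S n)).
  - rewrite <- plus_sum. apply sum_eq; intros i Hi. rewrite minus_INR, S_INR by lia. ring.
  - rewrite (decomp_sum (fun l => INR l * gbinom a l * gbinom b (S n - l))) by lia.
    rewrite (tech5 (fun l => gbinom a l * (INR (S n - l) * gbinom b (S n - l)))), Nat.sub_diag.
    change (INR 0) with 0. change (Init.Nat.pred (S n)) with n.
    match goal with |- 0 * ?x * ?y + ?s + (?t + ?z * (0 * ?w)) = _ =>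
      transitivity (s + t); [ring|] end.
    rewrite <- plus_sum. apply sum_eq; intros i Hi.
    replace (S n - S i)%nat with (n - i)%nat by lia.
    rewrite (S_INR i), gbinom_S.
    replace (S n - i)%nat with (S (n - i)) by lia.
    rewrite (S_INR (n - i)), gbinom_S, minus_INR by lia. ring.
Qed.

(* [q] is a polynomial function of degree less than [n]. *)
Fixpoint isP (n : nat) (q : R -> R) : Prop :=
  match n with
  | O => forall v, q v = 0
  | S k => exists c q', isP k q' /\ forall v, q v = c * v ^ k + q' v
  end.

Lemma isP_ext n q q' : (forall v, q v = q' v) -> isP n q -> isP n q'.
Proof.
  destruct n; simpl; intros Hq H.
  - intros v; now rewrite <- Hq.
  - destruct H as (c & r & Hr & H). exists c, r. split; [easy|]. intros; now rewrite <- Hq.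
Qed.

Lemma isP_plus n p q : isP n p -> isP n q -> isP n (fun v => p v + q v).
Proof.
  revert p q; induction n; simpl; intros p q Hp Hq.
  - intros v; rewrite Hp, Hq; ring.
  - destruct Hp as (c & r & Hr & Hp), Hq as (d & t & Ht & Hq).
    exists (c + d), (fun v => r v + t v). split; [now apply IHn|]. intros; rewrite Hp, Hq; ring.
Qed.

Lemma isP_scal n a p : isP n p -> isP n (fun v => a * p v).
Proof.
  revert p; induction n; simpl; intros p Hp.
  - intros v; rewrite Hp; ring.
  - destruct Hp as (c & r & Hr & Hp).
    exists (a * c), (fun v => a * r v). split; [now apply IHn|]. intros; rewrite Hp; ring.
Qed.

Lemma isP_weaken n p : isP n p -> isP (S n) p.
Proof. intros; exists 0, p; split; [easy|]; intros; ring. Qed.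

Lemma isP_mono n k p : (n <= k)%nat -> isP n p -> isP k p.
Proof. induction 1; [easy|]. intros; now apply isP_weaken, IHle. Qed.

Lemma isP_mulX n p : isP n p -> isP (S n) (fun v => v * p v).
Proof.
  revert p; induction n; intros p Hp.
  - simpl in Hp. exists 0, p. split; [easy|]. intros; rewrite Hp; ring.
  - destruct Hp as (c & r & Hr & Hp).
    exists c, (fun v => v * r v). split; [now apply IHn|]. intros; rewrite Hp; simpl; ring.
Qed.

Lemma isP_pow n : isP (S n) (fun v => v ^ n).
Proof.
  exists 1, (fun _ => 0). split; [|intros; ring].
  induction n; [easy|]. now apply isP_weaken.
Qed.

Lemma isP_cont n q : isP n q -> cont q.
Proof.
  revert q; induction n; intros q H.
  - intros x. apply continuous_ext with (fun _ => 0); [intros; symmetry; apply H|apply continuous_const].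
  - destruct H as (c & r & Hr & H). intros x.
    apply continuous_ext with (fun v => c * v ^ n + r v); [intros; symmetry; apply H|].
    apply cont_plus; auto with cont.
Qed.

Lemma isP_mom i j : isP (S (i + j)) (mom i j).
Proof.
  induction i.
  - apply isP_ext with (fun v => v ^ j); [unfold mom; simpl; intros; ring|apply isP_pow].
  - apply isP_ext with (fun v => mom i j v + -1 * (v * mom i j v)).
    + unfold mom; simpl; intros; ring.
    + apply isP_plus; [now apply isP_weaken|]. now apply (isP_scal _ (-1)), isP_mulX.
Qed.

Lemma shifted_pow_lead a b : exists q, isP (a + b) q /\ forall v, (v - 1) ^ a * v ^ b = v ^ (a + b) + q v.
Proof.
  induction a as [|a (q & Hq & H)].
  - exists (fun _ => 0). split; [|intros; simpl; ring].
    apply isP_mono with 0%nat; [lia|easy].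
  - exists (fun v => (v * q v + -1 * q v) + -1 * v ^ (a + b)). split.
    + simpl. apply (isP_plus (S (a + b)) (fun v => v * q v + -1 * q v)).
      * apply (isP_plus (S (a + b)) (fun v => v * q v)); [now apply isP_mulX|].
        now apply isP_weaken, (isP_scal _ (-1)).
      * apply (isP_scal _ (-1)), isP_pow.
    + intros v. replace ((v - 1) ^ S a * v ^ b) with ((v - 1) * ((v - 1) ^ a * v ^ b)) by (simpl; ring).
      rewrite H. simpl. ring.
Qed.

(** Each [(v - 1)^(n - l) v^l] is monic of degree [n], so the coefficients add up to the leading
    coefficient. *)
Definition jlead (al be : R) (n : nat) : R := sum_f_R0 (jc al be n) n.

Lemma jy_lead al be n : exists q, isP n q /\ forall v, jy al be n v = jlead al be n * v ^ n + q v.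
Proof.
  unfold jy, jlead.
  assert (HM : forall M, (M <= n)%nat -> exists q, isP n q /\ forall v,
    sum_f_R0 (fun l => jc al be n l * (v - 1) ^ (n - l) * v ^ l) M = sum_f_R0 (jc al be n) M * v ^ n + q v).
  { induction M as [|M IH]; intros HM.
    - destruct (shifted_pow_lead n 0) as (q & Hq & H). rewrite Nat.add_0_r in Hq.
      exists (fun v => jc al be n 0 * q v). split; [now apply isP_scal|].
      intros v. simpl. specialize (H v). rewrite Nat.add_0_r in H. rewrite Nat.sub_0_r.
      simpl in H. rewrite Rmult_assoc, H. ring.
    - destruct IH as (r & Hr & IH); [lia|].
      destruct (shifted_pow_lead (n - S M) (S M)) as (q & Hq & H).
      replace (n - S M + S M)%nat with n in * by lia.
      exists (fun v => r v + jc al be n (S M) * q v). split.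
      + apply isP_plus; [easy|now apply isP_scal].
      + intros v. rewrite !tech5, IH. rewrite (Rmult_assoc _ ((v - 1) ^ _)), H. ring. }
  apply HM; lia.
Qed.

Lemma jlead_eq al be n : jlead al be n = poch (INR n + al + be + 1) n / INR (fact n).
Proof.
  unfold jlead, jc. rewrite vandermonde.
  replace (INR n + al + (INR n + be)) with (INR n + (INR n + al + be)) by ring.
  apply gbinom_poch.
Qed.

Lemma jlead_pos al be n : adm al be -> 0 < jlead al be n.
Proof.
  intros H. unfold jlead.
  assert (HM : forall M, (M <= n)%nat -> 0 < sum_f_R0 (jc al be n) M).
  { induction M; intros; simpl; [now apply jc_pos|].
    apply Rplus_lt_0_compat; [apply IHM; lia|now apply jc_pos]. }
  apply HM; lia.
Qed.

Lemma E_mul_isP al be g k q : adm al be -> cont g -> isP k q ->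
  (forall j, (j < k)%nat -> E al be (fun v => g v * v ^ j) = 0) -> E al be (fun v => g v * q v) = 0.
Proof.
  intros H Hg. revert q; induction k; intros q Hq Hj.
  - rewrite (E_ext al be _ (fun _ => 0)); [now apply E_const|]. intros; simpl in Hq; rewrite Hq; ring.
  - destruct Hq as (c & r & Hr & Hq).
    rewrite (E_ext al be _ (fun v => c * (g v * v ^ k) + g v * r v)) by (intros; rewrite Hq; ring).
    pose proof (isP_cont _ _ Hr).
    rewrite (E_plus al be (fun v => c * (g v * v ^ k)) (fun v => g v * r v)) by auto with cont.
    rewrite (E_scal al be c (fun v => g v * v ^ k)) by auto with cont.
    rewrite Hj, IHk by (try easy; try lia; intros; apply Hj; lia). ring.
Qed.

Lemma E_jy_isP al be n q : adm al be -> isP n q -> E al be (fun v => jy al be n v * q v) = 0.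
Proof.
  intros. apply E_mul_isP with n; auto with cont. intros; now apply E_jy_pow_0.
Qed.

Lemma jy_isP al be n : isP (S n) (jy al be n).
Proof.
  destruct (jy_lead al be n) as (q & Hq & H). now exists (jlead al be n), q.
Qed.

Lemma E_jy_jy al be n k : adm al be -> n <> k -> E al be (fun v => jy al be n v * jy al be k v) = 0.
Proof.
  intros H Hn. destruct (Nat.lt_total n k) as [Hl|[Hl|Hl]]; [|easy|].
  - rewrite (E_ext al be _ (fun v => jy al be k v * jy al be n v)) by (intros; ring).
    apply E_jy_isP; [easy|]. apply isP_mono with (S n); [lia|apply jy_isP].
  - apply E_jy_isP; [easy|]. apply isP_mono with (S k); [lia|apply jy_isP].
Qed.

Definition jh (al be : R) (n : nat) : R := E al be (fun v => jy al be n v ^ 2).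

(** One of the two factors may be replaced by its leading term: the rest has degree below [n] and is
    orthogonal to [jy al be n]. *)
Lemma jh_lead al be n : adm al be -> jh al be n = jlead al be n * E al be (fun v => jy al be n v * v ^ n).
Proof.
  intros H. unfold jh. destruct (jy_lead al be n) as (q & Hq & HL).
  pose proof (isP_cont _ _ Hq).
  rewrite (E_ext al be _ (fun v => jlead al be n * (jy al be n v * v ^ n) + jy al be n v * q v)).
  2:{ intros. replace (jy al be n v ^ 2) with (jy al be n v * jy al be n v) by ring.
      rewrite (HL v) at 2. ring. }
  rewrite (E_plus al be (fun v => jlead al be n * (jy al be n v * v ^ n)) (fun v => jy al be n v * q v)) by auto with cont.
  rewrite (E_scal al be _ (fun v => jy al be n v * v ^ n)) by auto with cont.
  rewrite (E_jy_isP al be n q) by easy. ring.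
Qed.

Lemma jh_eq al be n : adm al be -> jh al be n =
  jlead al be n * (poch (al + 1) n * poch (be + 1) n / poch (al + be + 2) (n + n)).
Proof.
  intros H. rewrite jh_lead, E_jy_pow, Nat.sub_diag by easy. f_equal. simpl.
  pose proof (INR_fact_neq_0 n).
  assert (poch (al + be + 2) (n + n) <> 0) by (destruct H; apply Rgt_not_eq, poch_pos; lra).
  field. split; easy.
Qed.

Lemma jh_pos al be n : adm al be -> 0 < jh al be n.
Proof.
  intros H. rewrite jh_eq by easy. apply Rmult_lt_0_compat; [now apply jlead_pos|].
  destruct H. apply Rdiv_lt_0_compat; [apply Rmult_lt_0_compat|]; apply poch_pos; lra.
Qed.

Definition jp (al be : R) (n : nat) (v : R) : R := jy al be n v / sqrt (jh al be n).

Lemma cont_jp al be n : cont (jp al be n).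
Proof. unfold jp; auto with cont. Qed.
#[export] Hint Resolve cont_jp : cont.

Lemma jp_1_pos al be n : adm al be -> 0 < jp al be n 1.
Proof.
  intros. apply Rdiv_lt_0_compat; [now apply jy_1_pos|]. now apply sqrt_lt_R0, jh_pos.
Qed.

Lemma jp_1_sqr al be n : adm al be -> jp al be n 1 ^ 2 = jy al be n 1 ^ 2 / jh al be n.
Proof.
  intros H. pose proof (jh_pos al be n H) as Hp. unfold jp.
  replace (jh al be n) with (sqrt (jh al be n) * sqrt (jh al be n)) at 2 by (apply sqrt_sqrt; lra).
  pose proof (sqrt_lt_R0 _ Hp). field. lra.
Qed.

Lemma jp_0_eq al be v : adm al be -> jp al be 0 v = 1.
Proof.
  intros H. unfold jp.
  assert (Hy : forall v, jy al be 0 v = 1) by (intros; unfold jy, jc; simpl; rewrite !gbinom_0; ring).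
  unfold jh. rewrite (E_ext al be _ (fun _ => 1)) by (intros; rewrite Hy; ring).
  rewrite E_const, sqrt_1, Hy by easy. field.
Qed.

Lemma E_jp_jp al be n k : adm al be -> n <> k -> E al be (fun v => jp al be n v * jp al be k v) = 0.
Proof.
  intros H Hn. unfold jp.
  rewrite (E_ext al be _ (fun v => (/ sqrt (jh al be n) * / sqrt (jh al be k)) * (jy al be n v * jy al be k v)))
    by (intros; unfold Rdiv; ring).
  rewrite (E_scal al be _ (fun v => jy al be n v * jy al be k v)) by auto with cont.
  rewrite E_jy_jy by easy. ring.
Qed.

Lemma E_jp_sqr al be n : adm al be -> E al be (fun v => jp al be n v * jp al be n v) = 1.
Proof.
  intros H. pose proof (jh_pos al be n H) as Hp. unfold jp.
  rewrite (E_ext al be _ (fun v => (/ sqrt (jh al be n) * / sqrt (jh al be n)) * jy al be n v ^ 2))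
    by (intros; unfold Rdiv; ring).
  rewrite (E_scal al be _ (fun v => jy al be n v ^ 2)) by auto with cont.
  fold (jh al be n). rewrite <- Rinv_mult, sqrt_sqrt by lra. field. lra.
Qed.

(** The usual uniform formula contains [poch (al + be + 1) n / (al + be + 1)], which degenerates
    when [al + be = -1]. With index [S k] the offending factor cancels and leaves
    [poch (al + be + 2) k]. *)
Lemma jp_S_1_sqr al be k : adm al be -> jp al be (S k) 1 ^ 2 =
  poch (al + 1) (S k) * poch (al + be + 2) k * (al + be + 2 * INR k + 3)
   / (INR (fact (S k)) * poch (be + 1) (S k)).
Proof.
  intros H. rewrite jp_1_sqr, jy_1, gbinom_poch, jh_eq, jlead_eq by easy.
  replace (S k + S k)%nat with (k + S (S k))%nat by lia.
  rewrite (poch_add (al + be + 2) k (S (S k))).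
  change (poch (al + be + 2 + INR k) (S (S k))) with
    (poch (al + be + 2 + INR k) (S k) * (al + be + 2 + INR k + INR (S k))).
  replace (INR (S k) + al + be + 1) with (al + be + 2 + INR k) by (rewrite S_INR; ring).
  replace (al + be + 2 + INR k + INR (S k)) with (al + be + 2 * INR k + 3) by (rewrite S_INR; ring).
  destruct H as [Ha Hb]. pose proof (pos_INR k).
  pose proof (INR_fact_neq_0 (S k)).
  assert (poch (al + 1) (S k) <> 0) by (apply Rgt_not_eq, poch_pos; lra).
  assert (poch (be + 1) (S k) <> 0) by (apply Rgt_not_eq, poch_pos; lra).
  assert (poch (al + be + 2) k <> 0) by (apply Rgt_not_eq, poch_pos; lra).
  assert (poch (al + be + 2 + INR k) (S k) <> 0) by (apply Rgt_not_eq, poch_pos; lra).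
  field. repeat split; try easy. lra.
Qed.

(** The Christoffel-Darboux kernel at the endpoint. Its being a product, and not just a sum, is what
    later identifies it with beta integrals; the increment from [N] to [N + 1] is [jp_S_1_sqr]. *)
Lemma christoffel_1 al be N : adm al be ->
  sum_f_R0 (fun n => jp al be n 1 ^ 2) N =
  poch (al + be + 2) N * poch (al + 2) N / (poch (be + 1) N * INR (fact N)).
Proof.
  intros H. induction N as [|N IH].
  - simpl. rewrite jp_0_eq by easy. field.
  - rewrite tech5, IH, jp_S_1_sqr, poch_S_l by easy.
    replace (al + 1 + 1) with (al + 2) by ring.
    simpl poch. change (fact (S N)) with (S N * fact N)%nat. rewrite mult_INR, S_INR.
    destruct H as [Ha Hb]. pose proof (pos_INR N). pose proof (INR_fact_neq_0 N).
    assert (poch (be + 1) N <> 0) by (apply Rgt_not_eq, poch_pos; lra).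
    field. repeat split; try easy; lra.
Qed.

Lemma isP_span al be n q : adm al be -> isP (S n) q ->
  exists d : nat -> R, forall v, q v = sum_f_R0 (fun i => d i * jp al be i v) n.
Proof.
  intros H.
  assert (HS : forall k q, isP (S k) q -> exists c r, isP k r /\ forall v, q v = c * jp al be k v + r v).
  { intros k p (c & r & Hr & Hp). destruct (jy_lead al be k) as (t & Ht & HL).
    pose proof (jlead_pos al be k H). pose proof (sqrt_lt_R0 _ (jh_pos al be k H)).
    exists (c / jlead al be k * sqrt (jh al be k)), (fun v => r v + - (c / jlead al be k) * t v). split.
    - apply isP_plus; [easy|now apply isP_scal].
    - intros v. unfold jp. rewrite HL, Hp. field. lra. }
  revert q; induction n; intros q Hq.
  - destruct (HS _ _ Hq) as (c & r & Hr & Hc). exists (fun _ => c).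
    intros v; simpl in *; rewrite Hc, Hr; ring.
  - destruct (HS _ _ Hq) as (c & r & Hr & Hc). destruct (IHn r Hr) as (d & Hd).
    exists (fun i => if Nat.eq_dec i (S n) then c else d i).
    intros v. rewrite tech5, Hc, Hd. destruct (Nat.eq_dec (S n) (S n)); [|easy].
    rewrite Rplus_comm. f_equal. apply sum_eq; intros i Hi.
    destruct (Nat.eq_dec i (S n)); [lia|easy].
Qed.

Lemma isP_expand al be n q : adm al be -> isP (S n) q ->
  forall v, q v = sum_f_R0 (fun i => E al be (fun u => q u * jp al be i u) * jp al be i v) n.
Proof.
  intros H Hq v. destruct (isP_span al be n q H Hq) as (d & Hd). rewrite Hd at 1.
  apply sum_eq; intros i Hi. f_equal.
  rewrite (E_ext al be _ (fun u => sum_f_R0 (fun k => d k * (jp al be k u * jp al be i u)) n)).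
  2:{ intros u _. rewrite Hd, Rmult_comm, scal_sum. apply sum_eq; intros; ring. }
  rewrite (E_sum al be (fun k u => d k * (jp al be k u * jp al be i u))) by auto with cont.
  rewrite (sum_eq _ (fun k => if Nat.eq_dec k i then d i else 0)).
  2:{ intros k Hk. rewrite (E_scal al be (d k) (fun u => jp al be k u * jp al be i u)) by auto with cont.
      destruct (Nat.eq_dec k i); [subst; rewrite E_jp_sqr by easy|rewrite E_jp_jp by easy]; ring. }
  clear - Hi. induction n as [|n IH].
  - assert (i = 0)%nat by lia; subst. simpl. easy.
  - rewrite tech5. destruct (Nat.eq_dec (S n) i) as [Hn|Hn]; [subst i|].
    + rewrite (sum_eq _ (fun _ => 0)); [rewrite sum_cte; ring|].
      intros k Hk; destruct (Nat.eq_dec k (S n)); [lia|easy].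
    + rewrite <- IH by lia. ring.
Qed.

(** Parseval's identity with one polynomial factor: the sum is finite, so no convergence of the
    expansion of [f] is involved. *)
Lemma E_mul_expand al be f n q : adm al be -> cont f -> isP (S n) q ->
  E al be (fun v => f v * q v) =
  sum_f_R0 (fun i => E al be (fun u => q u * jp al be i u) * E al be (fun v => f v * jp al be i v)) n.
Proof.
  intros H Hf Hq.
  rewrite (E_ext al be _ (fun v => sum_f_R0 (fun i => E al be (fun u => q u * jp al be i u) * (f v * jp al be i v)) n)).
  2:{ intros v _. rewrite (isP_expand al be n q H Hq v) at 1. rewrite scal_sum. apply sum_eq; intros; ring. }
  rewrite (E_sum al be (fun i v => E al be (fun u => q u * jp al be i u) * (f v * jp al be i v))) by auto with cont.
  apply sum_eq; intros i Hi. rewrite (E_scal al be _ (fun v => f v * jp al be i v)); auto with cont.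
Qed.

(** * The Jacobi polynomials are maximal at the endpoint *)

Definition T0 (a b : nat) (v : R) : R := (v - 1) ^ a * v ^ b.
(** The first derivative of [T0]. The default [pred 0 = 0] is harmless, as its term carries the
    factor [INR 0]. *)
Definition T1 (a b : nat) (v : R) : R :=
  INR a * T0 (pred a) b v + INR b * T0 a (pred b) v.
Definition T2 (a b : nat) (v : R) : R :=
  INR a * T1 (pred a) b v + INR b * T1 a (pred b) v.

Lemma is_derive_T0 a b v : is_derive (T0 a b) v (T1 a b v).
Proof. unfold T0, T1. auto_derive; [easy|]. unfold T0. unfold Rminus. ring. Qed.

Lemma is_derive_T1 a b v : is_derive (T1 a b) v (T2 a b v).
Proof.
  unfold T1, T2.
  apply (is_derive_plus (K := R_AbsRing) (V := R_NormedModule)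
    (fun v => INR a * T0 (pred a) b v) (fun v => INR b * T0 a (pred b) v)).
  - apply (is_derive_scal (T0 (pred a) b) v (INR a)), is_derive_T0.
  - apply (is_derive_scal (T0 a (pred b)) v (INR b)), is_derive_T0.
Qed.

Lemma is_derive_sum_f (f df : nat -> R -> R) c n v : (forall i, is_derive (f i) v (df i v)) ->
  is_derive (fun v => sum_f_R0 (fun i => c i * f i v) n) v (sum_f_R0 (fun i => c i * df i v) n).
Proof.
  intros H. assert (H' : forall i, is_derive (fun v => c i * f i v) v (c i * df i v)).
  { intros i. now apply (is_derive_scal (f i) v (c i)). }
  induction n; simpl; [apply H'|].
  apply (is_derive_plus (K := R_AbsRing) (V := R_NormedModule)
    (fun v => sum_f_R0 (fun i => c i * f i v) n) (fun v => c (S n) * f (S n) v)); [easy|apply H'].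
Qed.

Definition jy' (al be : R) (n : nat) (v : R) : R :=
  sum_f_R0 (fun l => jc al be n l * T1 (n - l) l v) n.
Definition jy'' (al be : R) (n : nat) (v : R) : R :=
  sum_f_R0 (fun l => jc al be n l * T2 (n - l) l v) n.

Lemma is_derive_jy al be n v : is_derive (jy al be n) v (jy' al be n v).
Proof.
  apply is_derive_ext with (fun v => sum_f_R0 (fun l => jc al be n l * T0 (n - l) l v) n).
  - intros t; unfold jy, T0; apply sum_eq; intros; ring.
  - apply (is_derive_sum_f (fun l => T0 (n - l) l) (fun l => T1 (n - l) l)). intros; apply is_derive_T0.
Qed.

Lemma is_derive_jy' al be n v : is_derive (jy' al be n) v (jy'' al be n v).
Proof.
  apply (is_derive_sum_f (fun l => T1 (n - l) l) (fun l => T2 (n - l) l)). intros; apply is_derive_T1.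
Qed.

(* In the sum over [l] with [a = n - l] and [b = l], the right-hand side telescopes. *)
Lemma T_ode al be a b v :
  v * (1 - v) * T2 a b v + (be + 1 - (al + be + 2) * v) * T1 a b v
   + (INR a + INR b) * (INR a + INR b + al + be + 1) * T0 a b v
  = INR b * (INR b + be) * T0 a (pred b) v - INR a * (INR a + al) * T0 (pred a) b v.
Proof.
  unfold T2, T1, T0.
  destruct a as [|[|a]]; destruct b as [|[|b]]; simpl pred; rewrite ?S_INR; simpl (INR 0); simpl pow; ring.
Qed.

Lemma jc_step al be n l : (l < n)%nat ->
  jc al be n (S l) * (INR (S l) * (INR (S l) + be)) = jc al be n l * (INR (n - l) * (INR (n - l) + al)).
Proof.
  intros Hl. unfold jc. replace (n - l)%nat with (S (n - S l)) by lia.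
  assert (Hn : INR n = INR (n - S l) + INR l + 1) by (rewrite minus_INR, S_INR by lia; ring).
  rewrite !S_INR.
  transitivity (((INR l + 1) * gbinom (INR n + al) (S l)) * (INR l + 1 + be) * gbinom (INR n + be) (n - S l)); [ring|].
  transitivity (((INR (n - S l) + 1) * gbinom (INR n + be) (S (n - S l))) * (INR (n - S l) + 1 + al) * gbinom (INR n + al) l); [|ring].
  rewrite !gbinom_S. rewrite Hn. ring.
Qed.

Lemma jy_ode al be n v :
  v * (1 - v) * jy'' al be n v + (be + 1 - (al + be + 2) * v) * jy' al be n v
   + INR n * (INR n + al + be + 1) * jy al be n v = 0.
Proof.
  set (H := fun l => jc al be n l * (INR (n - l) * (INR (n - l) + al)) * T0 (pred (n - l)) l v).
  set (G := fun l => jc al be n l * (INR l * (INR l + be)) * T0 (n - l) (pred l) v).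
  transitivity (sum_f_R0 (fun l => G l - H l) n).
  - unfold jy'', jy', jy. rewrite !scal_sum, <- !plus_sum. apply sum_eq; intros l Hl.
    transitivity (jc al be n l * (v * (1 - v) * T2 (n - l) l v + (be + 1 - (al + be + 2) * v) * T1 (n - l) l v
      + (INR (n - l) + INR l) * (INR (n - l) + INR l + al + be + 1) * T0 (n - l) l v)).
    + rewrite minus_INR by easy. unfold T0. ring.
    + rewrite T_ode. unfold G, H. ring.
  (* [G 0 = 0] and, by [jc_step], [G (S l) = H l]; so the partial sum up to [M] is [- H M], and
     [H n = 0]. *)
  - assert (HM : forall M, (M <= n)%nat -> sum_f_R0 (fun l => G l - H l) M = - H M).
    { induction M; intros HM.
      - simpl. unfold G; simpl. ring.
      - rewrite tech5, IHM by lia.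
        replace (G (S M)) with (H M); [ring|].
        unfold G, H. rewrite <- jc_step by lia. simpl (pred (S M)).
        now replace (pred (n - M)) with (n - S M)%nat by lia. }
    rewrite HM by lia. unfold H. rewrite Nat.sub_diag. simpl (INR 0). ring.
Qed.

(* Sonin's function; its derivative is [jy'^2] times an affine function that changes sign at most once,
   from negative to positive. *)
Definition sonin (al be : R) (n : nat) (v : R) : R :=
  INR n * (INR n + al + be + 1) * jy al be n v ^ 2 + v * (1 - v) * jy' al be n v ^ 2.

Lemma is_derive_sonin al be n v :
  is_derive (sonin al be n) v (jy' al be n v ^ 2 * (2 * (al + be + 1) * v - (2 * be + 1))).
Proof.
  pose proof (is_derive_jy al be n v) as H0. pose proof (is_derive_jy' al be n v) as H1.
  pose proof (jy_ode al be n v) as HO.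
  unfold sonin. evar_last.
  - apply (is_derive_plus (K := R_AbsRing) (V := R_NormedModule)
      (fun v => INR n * (INR n + al + be + 1) * jy al be n v ^ 2) (fun v => v * (1 - v) * jy' al be n v ^ 2)).
    + apply (is_derive_scal (fun v => jy al be n v ^ 2) v (INR n * (INR n + al + be + 1))).
      apply (is_derive_pow (jy al be n) 2 v _ H0).
    + apply (is_derive_mult (K := R_AbsRing) (fun v => v * (1 - v)) (fun v => jy' al be n v ^ 2)).
      * instantiate (1 := 1 - 2 * v). auto_derive; [easy|ring].
      * apply (is_derive_pow (jy' al be n) 2 v _ H1).
      * intros; apply Rmult_comm.
  - unfold plus, mult; simpl.
    set (y := jy al be n v) in *; set (y1 := jy' al be n v) in *; set (y2 := jy'' al be n v) in *.
    set (L := INR n * (INR n + al + be + 1)) in *.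
    transitivity (2 * y1 * (v * (1 - v) * y2 + L * y) + (1 - 2 * v) * y1 ^ 2); [simpl; ring|].
    (* The differential equation eliminates the second derivative, leaving only multiples of
       [y1 ^ 2]. *)
    replace (v * (1 - v) * y2 + L * y) with (- ((be + 1 - (al + be + 2) * v) * y1)) by lra.
    ring.
Qed.

(** [sonin] dominates a positive multiple of [jy ^ 2], with equality at both ends. It first
    decreases and then increases, so it is largest at an endpoint, and [jy_01] compares the two
    endpoints. Degree 0 is separate because the multiple is then 0. *)
Lemma jy_bound al be n v : adm al be -> be <= al -> 0 <= v <= 1 -> Rabs (jy al be n v) <= jy al be n 1.
Proof.
  intros H Hab Hv. destruct n.
  { unfold jy, jc; simpl. rewrite !gbinom_0, Rabs_pos_eq; lra. }
  pose proof (jy_1_pos al be (S n) H) as Hp1. pose proof (jy_01 al be (S n) H Hab) as H01.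
  set (N := S n) in *. assert (HN : 1 <= INR N) by (subst N; rewrite S_INR; pose proof (pos_INR n); lra).
  destruct H as [Ha Hb].
  assert (HL : 0 < INR N * (INR N + al + be + 1)) by (apply Rmult_lt_0_compat; lra).
  assert (HC : forall x, continuity_pt (sonin al be N) x).
  { intros x. apply continuity_pt_filterlim, (ex_derive_continuous (K := R_AbsRing) (V := R_NormedModule)).
    eexists; apply is_derive_sonin. }
  assert (HF : sonin al be N v <= INR N * (INR N + al + be + 1) * jy al be N 1 ^ 2).
  (* The sign of the affine factor at [v] tells towards which endpoint [sonin] grows; its slope
     [2 (al + be + 1)] is nonnegative, so the sign persists all the way there. *)
  { destruct (Rle_lt_dec (2 * (al + be + 1) * v) (2 * be + 1)) as [Hc|Hc].
    - apply Rle_trans with (sonin al be N 0).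
      + destruct (MVT_gen (sonin al be N) 0 v _ (fun x _ => is_derive_sonin al be N x) (fun x _ => HC x)) as (c & Hc1 & Hc2).
        rewrite Rmin_left, Rmax_right in Hc1 by lra.
        assert (2 * (al + be + 1) * c <= 2 * (al + be + 1) * v) by (apply Rmult_le_compat_l; lra).
        pose proof (pow2_ge_0 (jy' al be N c)).
        assert (0 <= jy' al be N c ^ 2 * - (2 * (al + be + 1) * c - (2 * be + 1)) * v) by
          (apply Rmult_le_pos; [apply Rmult_le_pos|]; lra). lra.
      + unfold sonin. replace (0 * (1 - 0) * jy' al be N 0 ^ 2) with 0 by ring. rewrite Rplus_0_r.
        apply Rmult_le_compat_l; [lra|]. apply pow_maj_Rabs. exact H01.
    - apply Rle_trans with (sonin al be N 1).
      + destruct (MVT_gen (sonin al be N) v 1 _ (fun x _ => is_derive_sonin al be N x) (fun x _ => HC x)) as (c & Hc1 & Hc2).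
        rewrite Rmin_left, Rmax_right in Hc1 by lra.
        assert (2 * (al + be + 1) * v <= 2 * (al + be + 1) * c) by (apply Rmult_le_compat_l; lra).
        pose proof (pow2_ge_0 (jy' al be N c)).
        assert (0 <= jy' al be N c ^ 2 * (2 * (al + be + 1) * c - (2 * be + 1)) * (1 - v)) by
          (apply Rmult_le_pos; [apply Rmult_le_pos|]; lra). lra.
      + unfold sonin. lra. }
  apply Rsqr_incr_0_var; [|lra]. rewrite <- Rsqr_abs. unfold Rsqr.
  apply Rmult_le_reg_l with (INR N * (INR N + al + be + 1)); [easy|].
  assert (0 <= v * (1 - v) * jy' al be N v ^ 2).
  { apply Rmult_le_pos; [apply Rmult_le_pos; lra|apply pow2_ge_0]. }
  unfold sonin in HF. simpl pow in *. lra.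
Qed.

Lemma jp_bound al be n v : adm al be -> be <= al -> 0 <= v <= 1 -> Rabs (jp al be n v) <= jp al be n 1.
Proof.
  intros H Hab Hv. unfold jp, Rdiv. pose proof (sqrt_lt_R0 _ (jh_pos al be n H)) as Hs.
  rewrite Rabs_mult, (Rabs_pos_eq (/ _)) by (left; now apply Rinv_0_lt_compat).
  apply Rmult_le_compat_r; [left; now apply Rinv_0_lt_compat|]. now apply jy_bound.
Qed.

(** * The supremum of a function with eventually signed coefficients *)

Lemma cont_continuity_pt g x : cont g -> continuity_pt g x.
Proof. intros H; apply continuity_pt_filterlim, H. Qed.

Lemma cont_bounded g : cont g -> exists M, 0 <= M /\ forall v, 0 <= v <= 1 -> Rabs (g v) <= M.
Proof.
  intros Hg. destruct (continuity_ab_maj (fun v => Rabs (g v)) 0 1) as (c & Hc & _); [lra| |].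
  - intros; apply cont_continuity_pt; auto with cont.
  - exists (Rabs (g c)). split; [apply Rabs_pos|easy].
Qed.

(** Korovkin's form of continuity, ready to be integrated against a second moment: at distance at
    least [d] from [v0] the oscillation [2 M] is absorbed by [(2 M / d^2) (v - v0)^2]. *)
Lemma cont_quadratic g v0 eps : cont g -> 0 <= v0 <= 1 -> 0 < eps ->
  exists C, 0 <= C /\ forall v, 0 <= v <= 1 -> Rabs (g v - g v0) <= eps + C * (v - v0) ^ 2.
Proof.
  intros Hg Hv0 Heps. destruct (cont_bounded g Hg) as (M & HM0 & HM).
  destruct (cont_continuity_pt g v0 Hg eps Heps) as (d & Hd & HD).
  exists (2 * M / d ^ 2).
  assert (Hd2 : 0 < d ^ 2) by (apply pow_lt; lra).
  split.
  { apply Rmult_le_pos; [lra|left; now apply Rinv_0_lt_compat]. }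
  intros v Hv. pose proof (pow2_ge_0 (v - v0)).
  destruct (Rlt_le_dec (Rabs (v - v0)) d) as [Hlt|Hge].
  - assert (Rabs (g v - g v0) < eps).
    { destruct (Req_dec v v0) as [->|Hne]; [rewrite Rminus_diag, Rabs_R0; lra|].
      apply HD. split; [split; [easy|now apply not_eq_sym]|exact Hlt]. }
    assert (0 <= 2 * M / d ^ 2 * (v - v0) ^ 2).
    { apply Rmult_le_pos; [|easy]. apply Rmult_le_pos; [lra|left; now apply Rinv_0_lt_compat]. }
    lra.
  - assert (d ^ 2 <= (v - v0) ^ 2) by (rewrite <- (pow2_abs (v - v0)); apply pow_incr; lra).
    assert (2 * M <= 2 * M / d ^ 2 * (v - v0) ^ 2).
    { replace (2 * M) with (2 * M / d ^ 2 * d ^ 2) at 1 by (field; lra).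
      apply Rmult_le_compat_l; [|easy]. apply Rmult_le_pos; [lra|left; now apply Rinv_0_lt_compat]. }
    pose proof (Rabs_triang (g v) (- g v0)). rewrite Rabs_Ropp in *.
    pose proof (HM v Hv). pose proof (HM v0 Hv0). unfold Rminus at 1. lra.
Qed.

Lemma E_mom_right al be i j : adm al be ->
  E al be (mom i (S j)) = (be + INR j + 1) / (al + be + INR i + INR j + 2) * E al be (mom i j).
Proof.
  intros H. unfold E. change (J al be (mom i (S j))) with (m al be i (S j)).
  change (J al be (mom i j)) with (m al be i j). rewrite m_right by easy. unfold Rdiv; ring.
Qed.

(* Variance plus squared bias of a beta density: each is of order [1 / (i + j)]. *)
Lemma E_mom_dist al be i j v0 D : adm al be -> 0 <= v0 <= 1 ->
  Rabs (INR i - v0 * INR (i + j)) <= 1 -> D = al + 2 * be + 4 ->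
  E al be (fun v => (v - v0) ^ 2 * mom j i v) <= (1 + D ^ 2) / (INR (i + j) + 1) * E al be (mom j i).
Proof.
  intros H Hv0 Hi HD.
  rewrite (E_ext al be _ (fun v => (mom j (S (S i)) v + (- 2 * v0) * mom j (S i) v) + v0 ^ 2 * mom j i v)).
  2:{ intros; unfold mom; simpl; ring. }
  rewrite (E_plus al be (fun v => mom j (S (S i)) v + (- 2 * v0) * mom j (S i) v)
                        (fun v => v0 ^ 2 * mom j i v)) by auto with cont.
  rewrite (E_plus al be (fun v => mom j (S (S i)) v) (fun v => (- 2 * v0) * mom j (S i) v)) by auto with cont.
  rewrite (E_scal al be (- 2 * v0) (mom j (S i))), (E_scal al be (v0 ^ 2) (mom j i)) by auto with cont.
  change (E al be (fun v => mom j (S (S i)) v)) with (E al be (mom j (S (S i)))).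
  rewrite !E_mom_right by easy.
  pose proof (E_mom_pos al be j i H) as HQ. set (Q := E al be (mom j i)) in *.
  rewrite S_INR. rewrite plus_INR in *. destruct H as [Ha Hb].
  pose proof (pos_INR i) as Hi0. pose proof (pos_INR j) as Hj0.
  set (x := INR i) in *. set (y := INR j) in *.
  (* Against the weight, [mom j i] is an unnormalised beta density with mean [b / (a + b)] and
     variance [a b / ((a + b)^2 (a + b + 1))]. *)
  set (a := al + y + 1). set (b := be + x + 1).
  assert (Hs : 1 + x + y <= a + b) by (unfold a, b; lra).
  assert (Ha0 : 0 < a) by (unfold a; lra). assert (Hb0 : 0 < b) by (unfold b; lra).
  transitivity ((a * b / ((a + b) ^ 2 * (a + b + 1)) + (b - v0 * (a + b)) ^ 2 / (a + b) ^ 2) * Q).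
  { apply Req_le. unfold a, b. field. lra. }
  apply Rmult_le_compat_r; [lra|].
  (* Triangle inequality for [(x - v0 (x + y)) + (be + 1) - v0 (al + be + 2)]: the three terms are
     bounded by 1, [be + 1] and [al + be + 2], whose sum is [D]. *)
  assert (HD2 : (b - v0 * (a + b)) ^ 2 <= D ^ 2).
  { rewrite <- (pow2_abs (b - v0 * (a + b))). apply pow_incr. split; [apply Rabs_pos|].
    apply Rabs_le. apply Rabs_le_between in Hi. unfold a, b. subst D. nra. }
  assert (Hsq : 1 + x + y <= (a + b) ^ 2) by nra.
  assert (H1 : a * b / ((a + b) ^ 2 * (a + b + 1)) <= / (x + y + 1)).
  { apply Rle_trans with (/ (a + b)).
    - apply Rmult_le_reg_r with ((a + b) ^ 2 * (a + b + 1)).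
      + apply Rmult_lt_0_compat; [apply pow_lt|]; lra.
      + field_simplify; [|lra|lra]. nra.
    - apply Rinv_le_contravar; lra. }
  assert (H2 : (b - v0 * (a + b)) ^ 2 / (a + b) ^ 2 <= D ^ 2 / (x + y + 1)).
  { apply Rmult_le_compat; [apply pow2_ge_0|left; apply Rinv_0_lt_compat, pow_lt; lra|easy|].
    apply Rinv_le_contravar; lra. }
  unfold Rdiv in *. lra.
Qed.

(** The mean square distance of these densities from [v0] is of order [1 / N], so [cont_quadratic]
    makes them converge to the point mass at [v0]. *)
Lemma concentration al be g v0 (i : nat -> nat) : adm al be -> cont g -> 0 <= v0 <= 1 ->
  (forall N, (i N <= N)%nat /\ Rabs (INR (i N) - v0 * INR N) <= 1) ->
  is_lim_seq (fun N => E al be (fun v => g v * mom (N - i N) (i N) v) / E al be (mom (N - i N) (i N))) (g v0).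
Proof.
  intros H Hg Hv0 Hi. apply is_lim_seq_spec. intros eps. simpl.
  set (e := pos eps / 2). assert (He : 0 < e) by (unfold e; pose proof (cond_pos eps); lra).
  destruct (cont_quadratic g v0 e Hg Hv0 He) as (C & HC & HCv).
  set (K := C * (1 + (al + 2 * be + 4) ^ 2)).
  assert (HK : 0 <= K).
  { unfold K. apply Rmult_le_pos; [easy|]. pose proof (pow2_ge_0 (al + 2 * be + 4)); lra. }
  destruct (nfloor_ex (K / e)) as (N0 & _ & HN0).
  { apply Rmult_le_pos; [easy|left; now apply Rinv_0_lt_compat]. }
  exists N0. intros N HN. destruct (Hi N) as [Hi1 Hi2].
  set (q := mom (N - i N) (i N)). pose proof (E_mom_pos al be (N - i N) (i N) H) as HQ. fold q in HQ.
  assert (Hq : cont q) by apply cont_mom.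
  assert (Hq0 : forall v, 0 <= v <= 1 -> 0 <= q v).
  { intros v Hv. apply Rmult_le_pos; apply pow_le; lra. }
  replace (E al be (fun v => g v * q v) / E al be q - g v0) with (E al be (fun v => (g v - g v0) * q v) / E al be q).
  2:{ rewrite (E_ext al be _ (fun v => g v * q v - g v0 * q v)) by (intros; ring).
      rewrite (E_minus al be (fun v => g v * q v) (fun v => g v0 * q v)) by auto with cont.
      rewrite (E_scal al be (g v0) q) by auto with cont. field. lra. }
  unfold Rdiv. rewrite Rabs_mult, (Rabs_pos_eq (/ E al be q)) by (left; now apply Rinv_0_lt_compat).
  apply Rmult_lt_reg_r with (E al be q); [easy|]. rewrite Rmult_assoc, Rinv_l, Rmult_1_r by lra.
  apply Rle_lt_trans with (E al be (fun v => e * q v + C * ((v - v0) ^ 2 * q v))).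
  - eapply Rle_trans; [apply E_Rabs; auto with cont|].
    apply E_le; auto 8 with cont. intros v Hv. rewrite Rabs_mult, (Rabs_pos_eq (q v)) by auto.
    replace (e * q v + C * ((v - v0) ^ 2 * q v)) with ((e + C * (v - v0) ^ 2) * q v) by ring.
    apply Rmult_le_compat_r; auto.
  - rewrite (E_plus al be (fun v => e * q v) (fun v => C * ((v - v0) ^ 2 * q v))) by auto 8 with cont.
    rewrite (E_scal al be e q), (E_scal al be C (fun v => (v - v0) ^ 2 * q v)) by auto 8 with cont.
    assert (HD : E al be (fun v => (v - v0) ^ 2 * q v) <= (1 + (al + 2 * be + 4) ^ 2) / (INR N + 1) * E al be q).
    { pose proof (E_mom_dist al be (i N) (N - i N) v0 (al + 2 * be + 4) H Hv0) as HD.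
      replace (i N + (N - i N))%nat with N in HD by lia. now apply HD. }
    apply (Rmult_le_compat_l C) in HD; [|easy].
    assert (HN1 : K / (INR N + 1) < e).
    { apply le_INR in HN. pose proof (pos_INR N).
      apply Rmult_lt_reg_r with ((INR N + 1) * / e).
      - apply Rmult_lt_0_compat; [lra|now apply Rinv_0_lt_compat].
      - replace (K / (INR N + 1) * ((INR N + 1) * / e)) with (K / e) by (field; lra).
        replace (e * ((INR N + 1) * / e)) with (INR N + 1) by (field; lra). lra. }
    apply (Rmult_lt_compat_r (E al be q)) in HN1; [|easy].
    replace (C * ((1 + (al + 2 * be + 4) ^ 2) / (INR N + 1) * E al be q)) with
      (K / (INR N + 1) * E al be q) in HD by (unfold K; field; pose proof (pos_INR N); lra).
    replace (pos eps) with (e + e) by (unfold e; field). lra.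
Qed.

Lemma is_lim_seq_sum_f (u : nat -> nat -> R) (l : nat -> R) M :
  (forall n, is_lim_seq (fun N => u N n) (l n)) ->
  is_lim_seq (fun N => sum_f_R0 (u N) M) (sum_f_R0 l M).
Proof.
  intros H; induction M; simpl; [apply H|]. now apply is_lim_seq_plus'.
Qed.

Lemma sum_f_R0_le_ext (a : nat -> R) M N : (M <= N)%nat -> (forall n, (M < n)%nat -> 0 <= a n) ->
  sum_f_R0 a M <= sum_f_R0 a N.
Proof.
  induction 1 as [|N HN IH]; intros Ha; [lra|]. rewrite tech5.
  pose proof (IH Ha). pose proof (Ha (S N) ltac:(lia)). lra.
Qed.

Lemma E_jp_pow_ge0 al be n N : adm al be -> 0 <= E al be (fun v => mom 0 N v * jp al be n v).
Proof.
  intros H. rewrite (E_ext al be _ (fun v => / sqrt (jh al be n) * (jy al be n v * v ^ N))).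
  2:{ intros; unfold mom, jp, Rdiv; simpl; ring. }
  rewrite (E_scal al be _ (fun v => jy al be n v * v ^ N)) by auto with cont.
  apply Rmult_le_pos; [|now apply E_jy_pow_ge0].
  left; apply Rinv_0_lt_compat. now apply sqrt_lt_R0, jh_pos.
Qed.

(** Expand against [v^N], drop the nonnegative terms beyond [M], and let [N] grow with [M] fixed:
    the normalised kernel then has [n]-th coefficient tending to [jp al be n 1]. *)
Lemma coef_sum_le al be g k : adm al be -> cont g ->
  (forall n, (k <= n)%nat -> 0 <= E al be (fun v => g v * jp al be n v)) ->
  forall M, (k <= S M)%nat -> sum_f_R0 (fun n => jp al be n 1 * E al be (fun v => g v * jp al be n v)) M <= g 1.
Proof.
  intros H Hg Hk M HM.
  assert (Hi : forall N : nat, (N <= N)%nat /\ Rabs (INR N - 1 * INR N) <= 1).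
  { intros N; split; [lia|]. rewrite Rmult_1_l, Rminus_diag, Rabs_R0. lra. }
  assert (HL : forall f, cont f -> is_lim_seq (fun N => E al be (fun v => f v * mom 0 N v) / E al be (mom 0 N)) (f 1)).
  { intros f Hf. apply is_lim_seq_ext with (2 := concentration al be f 1 (fun N => N) H Hf ltac:(lra) Hi).
    intros N. now rewrite Nat.sub_diag. }
  apply (is_lim_seq_le_loc (fun N => sum_f_R0 (fun n => E al be (fun v => jp al be n v * mom 0 N v) / E al be (mom 0 N)
        * E al be (fun v => g v * jp al be n v)) M) (fun N => E al be (fun v => g v * mom 0 N v) / E al be (mom 0 N))
    (sum_f_R0 (fun n => jp al be n 1 * E al be (fun v => g v * jp al be n v)) M) (g 1)).
  - exists M. intros N HN. rewrite (E_mul_expand al be g N (mom 0 N)) by (easy || apply (isP_mom 0 N)).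
    unfold Rdiv at 2. rewrite (Rmult_comm (sum_f_R0 _ N)), scal_sum.
    apply Rle_trans with (sum_f_R0 (fun n => E al be (fun v => jp al be n v * mom 0 N v) / E al be (mom 0 N)
        * E al be (fun v => g v * jp al be n v)) N).
    + apply sum_f_R0_le_ext; [easy|]. intros n Hn.
      apply Rmult_le_pos; [|apply Hk; lia].
      apply Rmult_le_pos; [|left; apply Rinv_0_lt_compat; now apply E_mom_pos].
      rewrite (E_ext al be _ (fun v => mom 0 N v * jp al be n v)) by (intros; ring). now apply E_jp_pow_ge0.
    + apply Req_le, sum_eq. intros n Hn.
      rewrite (E_ext al be (fun v => jp al be n v * mom 0 N v) (fun v => mom 0 N v * jp al be n v)) by (intros; ring).
      unfold Rdiv; ring.
  - apply (is_lim_seq_sum_f (fun N n => E al be (fun v => jp al be n v * mom 0 N v) / E al be (mom 0 N)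
        * E al be (fun v => g v * jp al be n v))).
    intros n. apply (is_lim_seq_scal_r _ (E al be (fun v => g v * jp al be n v)) (jp al be n 1)).
    apply HL; auto with cont.
  - now apply HL.
Qed.

(** Replaces pointwise summation of the series. Every coefficient of the normalised kernel near [v0]
    is at most [jp al be n 1] in absolute value, by [jp_bound], so each average of [f] is bounded by
    a partial sum of the hypothesis. *)
Lemma sup_bound al be f S : adm al be -> be <= al -> cont f ->
  (forall M, sum_f_R0 (fun n => jp al be n 1 * Rabs (E al be (fun v => f v * jp al be n v))) M <= S) ->
  forall v0, 0 <= v0 <= 1 -> Rabs (f v0) <= S.
Proof.
  intros H Hab Hf HS v0 Hv0.
  assert (Hp : forall N, 0 <= v0 * INR N) by (intros; apply Rmult_le_pos; [lra|apply pos_INR]).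
  set (i := fun N => proj1_sig (nfloor_ex (v0 * INR N) (Hp N))).
  assert (Hi : forall N, (i N <= N)%nat /\ Rabs (INR (i N) - v0 * INR N) <= 1).
  { intros N. unfold i. destruct (nfloor_ex (v0 * INR N) (Hp N)) as (n & Hn1 & Hn2). simpl. split.
    - apply INR_le. pose proof (pos_INR N). nra.
    - apply Rabs_le. lra. }
  pose proof (concentration al be f v0 i H Hf Hv0 Hi) as HL.
  apply is_lim_seq_abs in HL. simpl in HL.
  apply (is_lim_seq_le _ (fun _ => S) (Rabs (f v0)) S) with (2 := HL); [|apply is_lim_seq_const].
  intros N. destruct (Hi N) as [Hi1 _]. set (q := mom (N - i N) (i N)).
  pose proof (E_mom_pos al be (N - i N) (i N) H) as HQ. fold q in HQ.
  assert (Hq0 : forall v, 0 <= v <= 1 -> 0 <= q v).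
  { intros v Hv. apply Rmult_le_pos; apply pow_le; lra. }
  assert (Hqc : cont q) by apply cont_mom.
  rewrite (E_mul_expand al be f N q H Hf).
  2:{ pose proof (isP_mom (N - i N) (i N)) as HP. now replace (N - i N + i N)%nat with N in HP by lia. }
  eapply Rle_trans; [|apply (HS N)].
  unfold Rdiv. rewrite (Rmult_comm (sum_f_R0 _ N)), scal_sum.
  eapply Rle_trans; [apply Rsum_abs|]. apply sum_Rle. intros n Hn.
  rewrite !Rabs_mult, (Rabs_pos_eq (/ E al be q)) by (left; now apply Rinv_0_lt_compat).
  rewrite (Rmult_comm (Rabs (E al be (fun u => q u * jp al be n u)))), Rmult_assoc, Rmult_comm.
  apply Rmult_le_compat_r; [apply Rabs_pos|].
  apply Rmult_le_reg_r with (E al be q); [easy|]. rewrite Rmult_assoc, Rinv_l, Rmult_1_r by lra.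
  eapply Rle_trans; [apply E_Rabs; auto with cont|].
  rewrite <- E_scal by auto with cont. apply E_le; auto with cont.
  intros v Hv. rewrite Rabs_mult, (Rabs_pos_eq (q v)), Rmult_comm by auto.
  apply Rmult_le_compat_r; [auto|]. now apply jp_bound.
Qed.

(** With [c n] the coefficients, split [|c n| = s c n + (|c n| - s c n)]. Weighted by
    [jp al be n 1], the first parts sum to at most [s * f 1 <= 0]; the second vanish for [n >= k]
    and are otherwise at most [2 |c n|], whence the factor 2. *)
Lemma sup_bound_L1 al be f s k : adm al be -> be <= al -> cont f -> (s = 1 \/ s = -1) -> (1 <= k)%nat ->
  (forall n, (k <= n)%nat -> 0 <= s * E al be (fun v => f v * jp al be n v)) -> s * f 1 <= 0 ->
  forall v, 0 <= v <= 1 ->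
    Rabs (f v) <= 2 * E al be (fun v => Rabs (f v)) * sum_f_R0 (fun n => jp al be n 1 ^ 2) (k - 1).
Proof.
  intros H Hab Hf Hs Hk Hn Hf1. set (c := fun n => E al be (fun v => f v * jp al be n v)).
  change (forall n, (k <= n)%nat -> 0 <= s * c n) in Hn.
  apply (sup_bound al be); try easy. fold c.
  assert (Hsc : forall n, s * c n = E al be (fun v => (s * f v) * jp al be n v)).
  { intros n. unfold c. rewrite <- (E_scal al be s (fun v => f v * jp al be n v)) by auto with cont.
    apply E_ext; intros; ring. }
  assert (HcL : forall n, Rabs (c n) <= jp al be n 1 * E al be (fun v => Rabs (f v))).
  { intros n. unfold c. eapply Rle_trans; [apply E_Rabs; auto with cont|].
    rewrite <- (E_scal al be _ (fun v => Rabs (f v))) by auto with cont. apply E_le; auto with cont.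
    intros v Hv. rewrite Rabs_mult, Rmult_comm. apply Rmult_le_compat_r; [apply Rabs_pos|]. now apply jp_bound. }
  assert (Hp : forall n, 0 < jp al be n 1) by (intros; now apply jp_1_pos).
  assert (Hscle : forall n, s * c n <= Rabs (c n) /\ - (s * c n) <= Rabs (c n)).
  { intros n. pose proof (Rle_abs (c n)). pose proof (Rle_abs (- c n)). rewrite Rabs_Ropp in *.
    destruct Hs; subst s; split; lra. }
  assert (HM : forall M, (k - 1 <= M)%nat ->
    sum_f_R0 (fun n => jp al be n 1 * (Rabs (c n) - s * c n)) M = sum_f_R0 (fun n => jp al be n 1 * (Rabs (c n) - s * c n)) (k - 1)).
  { induction 1 as [|M HM IH]; [easy|]. rewrite tech5, IH.
    replace (Rabs (c (S M))) with (s * c (S M)); [ring|].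
    pose proof (Hn (S M) ltac:(lia)). destruct Hs; subst s; [rewrite Rabs_pos_eq|rewrite Rabs_left1]; lra. }
  (* Enlarging [M] to [M + k] brings in all indices below [k] and makes [coef_sum_le] applicable. *)
  intros M. apply Rle_trans with (sum_f_R0 (fun n => jp al be n 1 * Rabs (c n)) (M + k)).
  { apply sum_f_R0_le_ext; [lia|]. intros; apply Rmult_le_pos; [left; apply Hp|apply Rabs_pos]. }
  pose proof (coef_sum_le al be (fun v => s * f v) k H ltac:(auto with cont)
    (fun n Hkn => eq_ind _ (fun x => 0 <= x) (Hn n Hkn) _ (Hsc n)) (M + k) ltac:(lia)) as HA.
  rewrite (sum_eq _ (fun n => jp al be n 1 * (s * c n) + jp al be n 1 * (Rabs (c n) - s * c n))) by (intros; ring).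
  rewrite plus_sum, (HM (M + k)%nat) by lia.
  rewrite (sum_eq (fun n => jp al be n 1 * (s * c n)) (fun n => jp al be n 1 * E al be (fun v => s * f v * jp al be n v)))
    by (intros; now rewrite Hsc).
  apply Rle_trans with (0 + sum_f_R0 (fun n => jp al be n 1 ^ 2 * (2 * E al be (fun v => Rabs (f v)))) (k - 1)).
  - apply Rplus_le_compat; [lra|]. apply sum_Rle. intros n _.
    replace (jp al be n 1 ^ 2 * (2 * E al be (fun v => Rabs (f v)))) with
      (jp al be n 1 * (2 * (jp al be n 1 * E al be (fun v => Rabs (f v))))) by ring.
    apply Rmult_le_compat_l; [left; apply Hp|]. pose proof (HcL n). pose proof (Hscle n). lra.
  - rewrite <- scal_sum. lra.
Qed.

(** * Mass near the endpoint and the Gamma function *)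

(** The unnormalised mass of [1 - rho <= v <= 1]: for [v = cos^2 th] this range is
    [sin th <= sqrt rho]. *)
Definition tail (al be rho : R) : R := RInt (jw al be) 0 (asin (sqrt rho)).

Lemma asin_sqrt_bounds rho : 0 <= rho <= 1 ->
  sin (asin (sqrt rho)) = sqrt rho /\ 0 <= asin (sqrt rho) <= PI / 2.
Proof.
  intros H. assert (Hs : 0 <= sqrt rho <= 1).
  { split; [apply sqrt_pos|]. rewrite <- sqrt_1. apply sqrt_le_1_alt; lra. }
  assert (HS : sin (asin (sqrt rho)) = sqrt rho) by (apply sin_asin; lra).
  split; [easy|]. pose proof (asin_bound (sqrt rho)) as HB. split; [|lra].
  destruct (Rle_lt_dec 0 (asin (sqrt rho))) as [|Hn]; [easy|].
  pose proof (sin_lt_0_var (asin (sqrt rho))) as Hv. pose proof PI_RGT_0. lra.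
Qed.

Lemma E_abs_tail al be f S rho : adm al be -> cont f -> 0 <= rho <= 1 ->
  E al be f <= 0 -> (forall v, 0 <= v < 1 - rho -> 0 <= f v) ->
  (forall v, 0 <= v <= 1 -> Rabs (f v) <= S) ->
  E al be (fun v => Rabs (f v)) <= 2 * S * (tail al be rho / J al be (fun _ => 1)).
Proof.
  intros H Hf Hr HE Hpos HS. set (h := fun v => Rabs (f v) - f v).
  assert (Hh : cont h) by (unfold h; auto with cont).
  apply Rle_trans with (E al be h).
  { rewrite (E_ext al be (fun v => Rabs (f v)) (fun v => f v + h v)) by (intros; unfold h; ring).
    rewrite E_plus by easy. lra. }
  unfold E. unfold Rdiv. rewrite <- Rmult_assoc.
  apply Rmult_le_compat_r; [left; apply Rinv_0_lt_compat; now apply J1_pos|].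
  destruct (asin_sqrt_bounds rho Hr) as [HT1 HT2]. unfold tail, J. set (T := asin (sqrt rho)) in *.
  pose proof (cont_J_integrand al be h H Hh) as Hc.
  rewrite <- (RInt_Chasles (V := R_CompleteNormedModule) _ 0 T (PI / 2)) by now apply cont_ex_RInt.
  (* [h] is twice the negative part of [f]; beyond [T] one has [v < 1 - rho], where it vanishes. *)
  rewrite (RInt_ext _ (fun _ => 0) T).
  - rewrite RInt_const. unfold plus, scal; simpl; unfold mult; simpl. rewrite Rmult_0_r, Rplus_0_r.
    rewrite <- (RInt_scal (V := R_CompleteNormedModule)) by (apply cont_ex_RInt; now apply cont_jw).
    apply RInt_le; [lra|now apply cont_ex_RInt| |].
    + apply (cont_ex_RInt (fun x => 2 * S * jw al be x)). apply cont_mult; [apply cont_const|now apply cont_jw].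
    + intros x Hx. unfold scal; simpl; unfold mult; simpl.
      apply Rmult_le_compat_r; [apply jw_ge0|]. unfold h.
      pose proof (HS _ (cos2_bounds x)) as HS'. pose proof (Rle_abs (- f (cos x ^ 2))) as HA.
      rewrite Rabs_Ropp in HA. simpl in *. lra.
  - rewrite Rmin_left, Rmax_right by lra. intros x Hx.
    replace (h (cos x ^ 2)) with 0; [apply Rmult_0_l|]. unfold h. rewrite Rabs_pos_eq; [ring|].
    apply Hpos. split; [apply cos2_bounds|].
    assert (HI : sin T < sin x) by (apply sin_increasing_1; lra).
    pose proof (sin2_cos2 x) as Hsc. unfold Rsqr in Hsc. rewrite HT1 in HI.
    pose proof (sqrt_pos rho). pose proof (sqrt_sqrt rho ltac:(lra)). nra.
Qed.

(** The weight with [be = 0], whose integral is elementary; it evaluates both the majorant of the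
    tail and the beta integral [B(al + 1, 1)]. *)
Lemma RInt_sin_pow al T : -1/2 <= al -> 0 <= T <= PI / 2 ->
  RInt (fun th => 2 * pw (sin th) (2 * al + 1) * cos th) 0 T = pw (sin T) (2 * al + 2) / (al + 1).
Proof.
  intros Ha HT.
  assert (Hp : forall e, 0 <= e -> cont (fun th => pw (sin th) e)).
  { intros e He. apply (cont_comp (fun x => pw x e) sin); [now apply cont_pw|apply cont_sin]. }
  rewrite (RInt_FTC _ (fun th => pw (sin th) (2 * al + 2) / (al + 1))).
  - rewrite sin_0, (pw_0 (2 * al + 2)) by lra. unfold Rdiv. rewrite Rmult_0_l. apply Rminus_0_r.
  - lra.
  - apply cont_mult; [|apply cont_cos]. apply cont_mult; [apply cont_const|apply Hp; lra].
  - intros x _. apply cont_div. apply Hp; lra.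
  - intros x Hx. destruct (sin_cos_pos x) as [Hs Hc]; [lra|].
    evar_last.
    + apply (is_derive_ext (fun th => / (al + 1) * pw (sin th) (2 * al + 2))); [intros; unfold Rdiv; apply Rmult_comm|].
      apply (is_derive_scal (fun th => pw (sin th) (2 * al + 2)) x (/ (al + 1))).
      apply (is_derive_comp (fun t => pw t _) sin); [now apply is_derive_pw|apply is_derive_sin].
    + unfold scal; simpl; unfold mult; simpl. replace (2 * al + 2 - 1) with (2 * al + 1) by ring. field. lra.
Qed.

Lemma exp_le_compat x y : x <= y -> exp x <= exp y.
Proof. intros [H|H]; [left; now apply exp_increasing|subst; lra]. Qed.

(** For [rho <= 3/4] the range has [cos th >= 1/2], so [cos^(2 be) <= 2] because [be >= -1/2]. This
    is the factor 2; what remains is the exact integral for [be = 0]. *)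
Lemma tail_le al be rho : adm al be -> 0 < rho <= 3 / 4 ->
  tail al be rho <= 2 * Rpower rho (al + 1) / (al + 1).
Proof.
  intros [Ha Hb] Hr. destruct (asin_sqrt_bounds rho) as [HT1 HT2]; [lra|].
  unfold tail. set (T := asin (sqrt rho)) in *.
  assert (Hrho : pw (sin T) (2 * al + 2) = Rpower rho (al + 1)).
  { rewrite HT1. replace (2 * al + 2) with (2 * (al + 1)) by ring.
    pose proof (sqrt_lt_R0 rho ltac:(lra)).
    rewrite <- pw_sqr by easy. simpl. rewrite Rmult_1_r, sqrt_sqrt by lra. apply pw_pos; lra. }
  replace (2 * Rpower rho (al + 1) / (al + 1)) with (2 * (pw (sin T) (2 * al + 2) / (al + 1))) by (rewrite Hrho; field; lra).
  rewrite <- RInt_sin_pow by easy.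
  assert (Hc : cont (fun th => 2 * pw (sin th) (2 * al + 1) * cos th)).
  { apply cont_mult; [|apply cont_cos]. apply cont_mult; [apply cont_const|].
    apply (cont_comp (fun x => pw x (2 * al + 1)) sin); [apply cont_pw; lra|apply cont_sin]. }
  rewrite <- (RInt_scal (V := R_CompleteNormedModule)) by now apply cont_ex_RInt.
  apply RInt_le; [lra|apply cont_ex_RInt; now apply cont_jw| |].
  - apply (cont_ex_RInt (fun th => 2 * (2 * pw (sin th) (2 * al + 1) * cos th))). apply cont_mult; [apply cont_const|easy].
  - intros x Hx. unfold scal; simpl; unfold mult; simpl.
    destruct (sin_cos_pos x) as [Hs Hcos]; [lra|].
    unfold jw. replace (2 * (2 * pw (sin x) (2 * al + 1) * cos x)) with (2 * pw (sin x) (2 * al + 1) * (2 * cos x)) by ring.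
    apply Rmult_le_compat_l; [apply Rmult_le_pos; [lra|apply pw_ge0]|].
    rewrite pw_plus, (pw_pos (cos x) 1), Rpower_1 by easy.
    apply Rmult_le_compat_r; [lra|]. rewrite pw_pos by easy.
    assert (Hhalf : 1 / 2 <= cos x).
    { assert (HI : sin x < sin T) by (apply sin_increasing_1; lra).
      pose proof (sin2_cos2 x) as Hsc. unfold Rsqr in Hsc. rewrite HT1 in HI.
      pose proof (sqrt_sqrt rho ltac:(lra)). nra. }
    assert (Hln0 : ln (cos x) <= 0).
    { rewrite <- ln_1. apply ln_le; [easy|]. apply COS_bound. }
    assert (Hln2 : - ln (cos x) <= ln 2).
    { rewrite <- ln_Rinv by easy. apply ln_le; [now apply Rinv_0_lt_compat|].
      replace 2 with (/ (1 / 2)) by field. apply Rinv_le_contravar; lra. }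
    unfold Rpower. apply Rle_trans with (exp (ln 2)); [|rewrite exp_ln; lra].
    apply exp_le_compat. nra.
Qed.

(** * Comparison of the Gamma integral with beta integrals *)

Lemma two_ln_le w : 1 <= w -> 2 * ln w <= w - / w.
Proof.
  intros Hw.
  destruct (MVT_gen (fun w => w - / w - 2 * ln w) 1 w (fun w => (1 - / w) ^ 2)) as (c & Hc & HM).
  - rewrite Rmin_left, Rmax_right by lra. intros x Hx. auto_derive; [repeat split; lra|]. field. lra.
  - rewrite Rmin_left, Rmax_right by lra. intros x Hx. apply continuity_pt_filterlim.
    apply (ex_derive_continuous (K := R_AbsRing) (V := R_NormedModule) (fun w => w - / w - 2 * ln w)).
    auto_derive. repeat split; lra.
  - rewrite ln_1, Rinv_1 in HM. pose proof (pow2_ge_0 (1 - / c)). simpl in *.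
    assert (0 <= (1 - / c) * ((1 - / c) * 1) * (w - 1)) by (apply Rmult_le_pos; lra). lra.
Qed.

Lemma ln_cos_le z : 0 < z <= 1 -> z * (-2 * ln z) <= 1 - z ^ 2.
Proof.
  intros Hz. assert (H1 : 1 <= / z) by (rewrite <- Rinv_1; apply Rinv_le_contravar; lra).
  pose proof (two_ln_le (/ z) H1) as H. rewrite ln_Rinv, Rinv_inv in H by lra.
  apply (Rmult_le_compat_l z) in H; [|lra]. field_simplify in H; [|lra]. lra.
Qed.

(** The integrand of [Gamma (a + 1)]. *)
Definition gamma_fun (a t : R) : R := rpow t a * exp (- t).

Lemma gamma_fun_eq a t : 0 < t -> gamma_fun a t = pw t a * exp (- t).
Proof. intros; unfold gamma_fun, rpow; rewrite pw_pos by easy. destruct (Rlt_dec 0 t); lra. Qed.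

Lemma gamma_fun_pos a t : 0 < t -> 0 < gamma_fun a t.
Proof. intros; rewrite gamma_fun_eq by easy. apply Rmult_lt_0_compat; [now apply pw_gt0|apply exp_pos]. Qed.

Lemma gamma_fun_continuous a t : 0 < t -> continuous (gamma_fun a) t.
Proof.
  intros H. apply (ex_derive_continuous (K := R_AbsRing) (V := R_NormedModule)).
  apply (ex_derive_ext_loc (fun t => pw t a * exp (- t))).
  - exists (mkposreal t H); intros y Hy.
    rewrite gamma_fun_eq; [easy|].
    unfold ball in Hy; simpl in Hy; unfold AbsRing_ball, abs, minus, plus, opp in Hy; simpl in Hy.
    apply Rabs_def2 in Hy; lra.
  - apply (ex_derive_mult (fun t => pw t a) (fun t => exp (- t))).
    + eexists; now apply is_derive_pw.
    + auto_derive. easy.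
Qed.

Lemma gamma_fun_ex a e T : 0 < e -> 0 < T -> ex_RInt (gamma_fun a) e T.
Proof.
  intros He HT. apply (ex_RInt_continuous (V := R_CompleteNormedModule)).
  intros z Hz. apply gamma_fun_continuous. pose proof (Rmin_glb_lt e T 0). lra.
Qed.

(* Substituting [t = - 2 c ln (cos th)] and using [- 2 z ln z <= 1 - z^2] with [z = cos th]. *)
Lemma gamma_partial_le al be j e T : adm al be -> 0 < e <= T ->
  let c := be + INR j + 1 + (al + 1) / 2 in
  RInt (gamma_fun (al + 1)) e T <= Rpower c (al + 2) * m al be 1 j.
Proof.
  intros H HeT c. pose proof H as [Ha Hb]. pose proof (pos_INR j) as Hj.
  assert (Hc : 0 < c) by (unfold c; lra).
  set (phi := fun th => - 2 * c * ln (cos th)).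
  set (inv := fun y => acos (exp (- y / (2 * c)))).
  assert (Hinv : forall y, 0 < y -> phi (inv y) = y /\ 0 < inv y < PI / 2).
  { intros y Hy. assert (Hx : 0 < exp (- y / (2 * c)) < 1).
    { split; [apply exp_pos|]. rewrite <- exp_0. apply exp_increasing.
      apply Rmult_lt_reg_r with (2 * c); [lra|]. field_simplify; lra. }
    assert (HC : cos (inv y) = exp (- y / (2 * c))) by (unfold inv; apply cos_acos; lra).
    split.
    - unfold phi. rewrite HC, ln_exp. field. lra.
    - pose proof (acos_bound (exp (- y / (2 * c)))) as HB. fold (inv y) in HB.
      split.
      + destruct (Req_dec (inv y) 0) as [E0|]; [rewrite E0, cos_0 in HC; lra|lra].
      + destruct (Rlt_le_dec (inv y) (PI / 2)) as [|Hge]; [easy|].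
        assert (cos (inv y) <= 0) by (apply cos_le_0; pose proof PI_RGT_0; lra). lra. }
  destruct (Hinv e) as [He1 He2]; [lra|]. destruct (Hinv T) as [HT1 HT2]; [lra|].
  assert (Hmono : inv e <= inv T).
  { destruct (Rle_lt_dec (inv e) (inv T)) as [|Hlt]; [easy|].
    assert (cos (inv e) < cos (inv T)) by (apply cos_decreasing_1; lra).
    assert (ln (cos (inv e)) < ln (cos (inv T))) by (apply ln_increasing; [now apply sin_cos_pos|easy]).
    assert (phi (inv e) > phi (inv T)) by (unfold phi; nra). lra. }
  set (dphi := fun th => 2 * c * (sin th / cos th)).
  assert (Hcomp : RInt (fun th => scal (dphi th) (gamma_fun (al + 1) (phi th))) (inv e) (inv T) = RInt (gamma_fun (al + 1)) e T).
  { rewrite <- He1 at 2. rewrite <- HT1 at 2.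
    apply (RInt_comp (V := R_CompleteNormedModule) (gamma_fun (al + 1)) phi dphi).
    - rewrite Rmin_left, Rmax_right by easy. intros x Hx. apply gamma_fun_continuous.
      destruct (sin_cos_pos x) as [Hs Hcs]; [lra|].
      assert (ln (cos x) < 0).
      { rewrite <- ln_1. apply ln_increasing; [easy|]. rewrite <- cos_0. apply cos_decreasing_1; lra. }
      unfold phi. nra.
    - rewrite Rmin_left, Rmax_right by easy. intros x Hx.
      destruct (sin_cos_pos x) as [Hs Hcs]; [lra|]. split.
      + unfold phi, dphi. auto_derive; [easy|]. field. lra.
      + apply (ex_derive_continuous (K := R_AbsRing) (V := R_NormedModule)). unfold dphi. auto_derive. lra. }
  rewrite <- Hcomp.
  set (G := fun th => Rpower c (al + 2) * (mom 1 j (cos th ^ 2) * jw al be th)).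
  assert (HG : cont G) by (apply cont_mult; [apply cont_const|apply cont_J_integrand; auto with cont]).
  assert (HG0 : forall x, 0 <= G x).
  { intros x. apply Rmult_le_pos; [left; apply exp_pos|]. apply Rmult_le_pos; [|apply jw_ge0].
    unfold mom. pose proof (cos2_bounds x). apply Rmult_le_pos; apply pow_le; lra. }
  apply Rle_trans with (RInt G (inv e) (inv T)).
  - apply RInt_le; [easy| |now apply cont_ex_RInt|].
    + apply (ex_RInt_continuous (V := R_CompleteNormedModule)).
      rewrite Rmin_left, Rmax_right by easy. intros x Hx.
      destruct (sin_cos_pos x) as [Hs Hcs]; [lra|].
      apply (continuous_mult (K := R_AbsRing) dphi (fun x => gamma_fun (al + 1) (phi x))).
      * apply (ex_derive_continuous (K := R_AbsRing) (V := R_NormedModule)). unfold dphi. auto_derive. lra.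
      * apply (continuous_comp phi (gamma_fun (al + 1))).
        -- apply (ex_derive_continuous (K := R_AbsRing) (V := R_NormedModule)). unfold phi. auto_derive. lra.
        -- apply gamma_fun_continuous.
           assert (ln (cos x) < 0).
           { rewrite <- ln_1. apply ln_increasing; [easy|]. rewrite <- cos_0. apply cos_decreasing_1; lra. }
           unfold phi. nra.
    + intros x Hx. destruct (sin_cos_pos x) as [Hs Hcs]; [lra|].
      unfold scal; simpl; unfold mult; simpl. unfold G. rewrite mom_jw by (easy || lra).
      assert (Hln : ln (cos x) < 0).
      { rewrite <- ln_1. apply ln_increasing; [easy|]. rewrite <- cos_0. apply cos_decreasing_1; lra. }
      assert (Hphi : 0 < phi x) by (unfold phi; nra).
      rewrite gamma_fun_eq by easy.
      set (z := cos x) in *. set (s := sin x) in *.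
      (* The left side is [z^(2 c)], and [c] is chosen for this splitting: the power of [cos] in the
         weight, one [z] to cancel the denominator of [dphi], and [z^(al + 1)] to pair with the
         power of [-2 ln z] in [E5]. *)
      assert (E1 : exp (- phi x) = pw z (2 * (be + INR j) + 1) * z * pw z (al + 1)).
      { replace z with (pw z 1) at 2 by (rewrite pw_pos, Rpower_1 by easy; easy).
        rewrite <- !pw_plus by easy. rewrite pw_pos by easy. unfold Rpower, phi, c. f_equal. fold z. field. }
      assert (E2 : pw (phi x) (al + 1) = pw c (al + 1) * pw (-2 * ln z) (al + 1)).
      { rewrite <- pw_mult_base by lra. f_equal. unfold phi. fold z. ring. }
      assert (E3 : Rpower c (al + 2) = c * pw c (al + 1)).
      { replace (al + 2) with (1 + (al + 1)) by ring. rewrite Rpower_plus, Rpower_1, pw_pos by easy. easy. }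
      assert (E4 : pw s (2 * (al + INR 1) + 1) = s * pw (1 - z ^ 2) (al + 1)).
      { replace (1 - z ^ 2) with (s ^ 2) by (pose proof (sin2_cos2 x) as Hsc; unfold Rsqr in Hsc; fold s z in Hsc; lra).
        rewrite pw_sqr by easy. simpl (INR 1). rewrite (pw_plus s _ 1), (pw_pos s 1), Rpower_1 by easy. ring. }
      assert (E5 : pw z (al + 1) * pw (-2 * ln z) (al + 1) <= pw (1 - z ^ 2) (al + 1)).
      { rewrite <- pw_mult_base by lra. apply pw_incr; [lra|]. split; [apply Rmult_lt_0_compat; lra|].
        apply ln_cos_le. split; [easy|apply COS_bound]. }
      rewrite E1, E2, E3, E4. unfold dphi. fold z s.
      replace (2 * c * (s / z) * (pw c (al + 1) * pw (-2 * ln z) (al + 1) *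
         (pw z (2 * (be + INR j) + 1) * z * pw z (al + 1)))) with
        (2 * c * pw c (al + 1) * s * pw z (2 * (be + INR j) + 1) * (pw z (al + 1) * pw (-2 * ln z) (al + 1)))
        by (field; lra).
      replace (c * pw c (al + 1) * (2 * (s * pw (1 - z ^ 2) (al + 1)) * pw z (2 * (be + INR j) + 1))) with
        (2 * c * pw c (al + 1) * s * pw z (2 * (be + INR j) + 1) * pw (1 - z ^ 2) (al + 1)) by ring.
      apply Rmult_le_compat_l; [|exact E5].
      repeat apply Rmult_le_pos; try lra; apply pw_ge0.
  - assert (HJ : RInt G 0 (PI / 2) = Rpower c (al + 2) * m al be 1 j).
    { unfold m, J. rewrite <- (RInt_scal (V := R_CompleteNormedModule)).
      - easy.
      - apply cont_ex_RInt, cont_J_integrand; auto with cont. }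
    rewrite <- HJ.
    rewrite <- (RInt_Chasles (V := R_CompleteNormedModule) G 0 (inv e) (PI / 2)) by now apply cont_ex_RInt.
    rewrite <- (RInt_Chasles (V := R_CompleteNormedModule) G (inv e) (inv T) (PI / 2)) by now apply cont_ex_RInt.
    unfold plus; simpl.
    assert (0 <= RInt G 0 (inv e)) by (apply RInt_ge_0; [lra|now apply cont_ex_RInt|easy]).
    assert (0 <= RInt G (inv T) (PI / 2)) by (apply RInt_ge_0; [lra|now apply cont_ex_RInt|easy]).
    lra.
Qed.

Lemma gamma_partial_mono a e T e' T' : 0 < e' <= e -> e <= T <= T' ->
  RInt (gamma_fun a) e T <= RInt (gamma_fun a) e' T'.
Proof.
  intros He HT.
  rewrite <- (RInt_Chasles (V := R_CompleteNormedModule) (gamma_fun a) e' e T') by (apply gamma_fun_ex; lra).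
  rewrite <- (RInt_Chasles (V := R_CompleteNormedModule) (gamma_fun a) e T T') by (apply gamma_fun_ex; lra).
  unfold plus; simpl.
  assert (0 <= RInt (gamma_fun a) e' e).
  { apply RInt_ge_0; [lra|apply gamma_fun_ex; lra|]. intros; left; apply gamma_fun_pos; lra. }
  assert (0 <= RInt (gamma_fun a) T T').
  { apply RInt_ge_0; [lra|apply gamma_fun_ex; lra|]. intros; left; apply gamma_fun_pos; lra. }
  lra.
Qed.

(** The partial integrals grow with the interval and are bounded, by [gamma_partial_le] with
    [be = 0] and [j = 0]; their supremum is the limit. Only this existence gives the [epsilon] in
    [Gamma] a meaning. *)
Lemma Gamma_spec al : -1/2 <= al ->
  forall eps, 0 < eps -> exists d, 0 < d /\ exists T0, forall e T, 0 < e < d -> T0 < T -> e < T /\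
    Rabs (RInt (gamma_fun (al + 1)) e T - Gamma (al + 2)) < eps.
Proof.
  intros Ha.
  assert (Hadm : adm al 0) by (split; lra).
  set (P := fun l => forall eps, 0 < eps -> exists d, 0 < d /\ exists T0, forall e T, 0 < e < d -> T0 < T ->
        exists pr : Riemann_integrable (fun t => rpow t (al + 2 - 1) * exp (- t)) e T,
          Rabs (RiemannInt pr - l) < eps).
  assert (HP : P (Gamma (al + 2))).
  { apply (epsilon_spec (inhabits 0) P).
    set (S := fun y => exists e T, 0 < e <= T /\ y = RInt (gamma_fun (al + 1)) e T).
    destruct (completeness S) as (l & Hl1 & Hl2).
    - exists (Rpower (0 + INR 0 + 1 + (al + 1) / 2) (al + 2) * m al 0 1 0).
      intros y (e & T & He & ->). now apply (gamma_partial_le al 0 0 e T).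
    - exists (RInt (gamma_fun (al + 1)) 1 2), 1, 2. split; [lra|easy].
    - exists l. intros eps Heps.
      assert (Hex : exists e T, 0 < e <= T /\ l - eps < RInt (gamma_fun (al + 1)) e T).
      { apply NNPP. intros HN. assert (l <= l - eps); [|lra]. apply Hl2.
        intros y (e & T & He & ->). apply Rnot_lt_le. intros Hlt. apply HN. now exists e, T. }
      destruct Hex as (e0 & T0 & He0 & HeT). exists e0. split; [lra|]. exists T0. intros e T He HT.
      assert (Hi : ex_RInt (fun t => rpow t (al + 2 - 1) * exp (- t)) e T).
      { replace (al + 2 - 1) with (al + 1) by ring. apply (gamma_fun_ex (al + 1)); lra. }
      exists (ex_RInt_Reals_0 _ _ _ Hi). rewrite <- RInt_Reals.
      replace (al + 2 - 1) with (al + 1) by ring.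
      change (fun t : R => rpow t (al + 1) * exp (- t)) with (gamma_fun (al + 1)).
      pose proof (gamma_partial_mono (al + 1) e0 T0 e T ltac:(lra) ltac:(lra)).
      assert (RInt (gamma_fun (al + 1)) e T <= l) by (apply Hl1; exists e, T; split; [lra|easy]).
      apply Rabs_lt_between. lra. }
  intros eps Heps. destruct (HP eps Heps) as (d & Hd & T0 & HT). exists d. split; [easy|].
  (* Taking the upper limit beyond [d] forces [e < T]. *)
  exists (Rmax T0 d). intros e T He HT'. pose proof (Rmax_l T0 d). pose proof (Rmax_r T0 d).
  split; [lra|]. destruct (HT e T He ltac:(lra)) as (pr & Hpr). rewrite <- RInt_Reals in Hpr.
  now replace (al + 2 - 1) with (al + 1) in Hpr by ring.
Qed.

Lemma Gamma_pos al : -1/2 <= al -> 0 < Gamma (al + 2).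
Proof.
  intros Ha. set (I := RInt (gamma_fun (al + 1)) 1 2).
  assert (HI : 0 < I).
  { apply RInt_gt_0; [lra| |]; intros; [apply gamma_fun_pos|apply gamma_fun_continuous]; lra. }
  destruct (Gamma_spec al Ha I HI) as (d & Hd & T0 & HT).
  assert (Hm : 0 < Rmin d 1) by (apply Rmin_glb_lt; lra).
  pose proof (Rmin_l d 1); pose proof (Rmin_r d 1). pose proof (Rmax_l T0 2); pose proof (Rmax_r T0 2).
  destruct (HT (Rmin d 1 / 2) (Rmax T0 2 + 1)) as [_ HB]; [lra|lra|].
  pose proof (gamma_partial_mono (al + 1) 1 2 (Rmin d 1 / 2) (Rmax T0 2 + 1) ltac:(lra) ltac:(lra)) as HM.
  fold I in HM. apply Rabs_lt_between in HB. lra.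
Qed.

(** [m_left] passes from index 1 to index 0 with a factor [(al + 1) / (al + be + j + 2)], whose
    denominator absorbs the extra power of [c] because [c <= al + be + j + 2]. *)
Lemma Gamma_le al be j : adm al be ->
  Gamma (al + 2) <= Rpower (be + INR j + 1 + (al + 1) / 2) (al + 1) * ((al + 1) * m al be 0 j).
Proof.
  intros H. pose proof H as [Ha Hb]. pose proof (pos_INR j) as Hj.
  set (c := be + INR j + 1 + (al + 1) / 2). assert (Hc : 0 < c) by (unfold c; lra).
  apply Rle_trans with (Rpower c (al + 2) * m al be 1 j).
  - apply le_epsilon. intros eps Heps.
    destruct (Gamma_spec al Ha eps Heps) as (d & Hd & T0 & HT).
    destruct (HT (d / 2) (T0 + 1)) as [H1 HB]; [lra|lra|].
    pose proof (gamma_partial_le al be j (d / 2) (T0 + 1) H ltac:(lra)) as HG. simpl in HG. fold c in HG.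
    apply Rabs_lt_between in HB. lra.
  - rewrite m_left by easy. simpl (INR 0). rewrite !Rplus_0_r.
    replace (al + 2) with (al + 1 + 1) by ring. rewrite Rpower_plus, Rpower_1, Rmult_assoc by easy.
    apply Rmult_le_compat_l; [left; apply exp_pos|].
    replace (c * ((al + 1) / (al + be + INR j + 2) * m al be 0 j)) with
      (c / (al + be + INR j + 2) * ((al + 1) * m al be 0 j)) by (field; lra).
    pose proof (m_pos al be 0 j H) as Hm.
    rewrite <- Rmult_1_l. apply Rmult_le_compat_r; [apply Rmult_le_pos; lra|].
    apply Rmult_le_reg_r with (al + be + INR j + 2); [lra|]. field_simplify; [|lra]. unfold c. lra.
Qed.

(** * The sign uncertainty bounds *)

Lemma m00_be0 al : -1/2 <= al -> (al + 1) * m al 0 0 0 = 1.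
Proof.
  intros Ha. rewrite m00. unfold J.
  rewrite (RInt_ext _ (fun th => 2 * pw (sin th) (2 * al + 1) * cos th)).
  - pose proof PI2_pos. rewrite RInt_sin_pow, sin_PI2, pw_pos by lra.
    replace (Rpower 1 (2 * al + 2)) with 1 by (unfold Rpower; now rewrite ln_1, Rmult_0_r, exp_0). field. lra.
  - pose proof PI2_pos. rewrite Rmin_left, Rmax_right by lra. intros x Hx.
    destruct (sin_cos_pos x Hx) as [Hs Hc]. unfold jw.
    replace (2 * 0 + 1) with 1 by ring. rewrite (pw_pos (cos x) 1), Rpower_1 by easy. apply Rmult_1_l.
Qed.

Lemma poch_1 n : poch 1 n = INR (fact n).
Proof.
  induction n; [easy|]. change (fact (S n)) with (S n * fact n)%nat.
  rewrite mult_INR, S_INR, <- IHn. simpl. ring.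
Qed.

(* The two factors are [B(al + 1, be + N + 1)] and [(al + 1) B(al + 1, N + 1)]. *)
Lemma christoffel_beta al be N : adm al be ->
  sum_f_R0 (fun n => jp al be n 1 ^ 2) N * (m al be 0 N * ((al + 1) * m al 0 0 N)) = J al be (fun _ => 1).
Proof.
  intros H. rewrite christoffel_1 by easy. pose proof H as [Ha Hb].
  assert (H0 : adm al 0) by (split; lra).
  rewrite (m_poch al be 0 N H), (m_poch al 0 0 N H0), m00.
  replace (0 + 1) with 1 by ring. rewrite poch_1.
  pose proof (m00_be0 al Ha) as H1. pose proof (INR_fact_neq_0 N).
  assert (poch (al + be + 2) N <> 0) by (apply Rgt_not_eq, poch_pos; lra).
  assert (poch (be + 1) N <> 0) by (apply Rgt_not_eq, poch_pos; lra).
  assert (poch (al + 2) N <> 0) by (apply Rgt_not_eq, poch_pos; lra).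
  replace (al + 0 + 2) with (al + 2) by ring.
  replace (m al 0 0 0) with (/ (al + 1)) by (apply Rmult_eq_reg_l with (al + 1); [rewrite H1; field|]; lra).
  simpl Nat.add. simpl (poch _ 0). field. repeat split; try easy. lra.
Qed.

(** Serves the case [rho > 3/4], with [a = al + 1]; [a + 1/2] is the least value of [al + be + 2].
    For [a >= 1] the bases already compare, with equality at [a = 1]; for [a < 1] they compare up to
    a factor 2, and [2^a <= 2]. *)
Lemma Rpower_ratio_bound a : 1 / 2 <= a ->
  Rpower ((1 + a / 2) ^ 2) a <= 8 * Rpower (3 / 4 * ((a + 1) * (a + 1 / 2))) a.
Proof.
  intros Ha.
  assert (HY : 0 < 3 / 4 * ((a + 1) * (a + 1 / 2))) by (repeat apply Rmult_lt_0_compat; lra).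
  assert (HX : 0 < (1 + a / 2) ^ 2) by (apply pow_lt; lra).
  assert (HP : 0 < Rpower (3 / 4 * ((a + 1) * (a + 1 / 2))) a) by apply exp_pos.
  destruct (Rle_lt_dec 1 a) as [H1|H1].
  - apply Rle_trans with (Rpower (3 / 4 * ((a + 1) * (a + 1 / 2))) a); [|lra].
    apply Rle_Rpower_l; [lra|]. split; [easy|]. nra.
  - apply Rle_trans with (Rpower (2 * (3 / 4 * ((a + 1) * (a + 1 / 2)))) a).
    + apply Rle_Rpower_l; [lra|]. split; [easy|]. nra.
    + rewrite <- Rpower_mult_distr by lra. apply Rmult_le_compat_r; [lra|].
      apply Rle_trans with (Rpower 2 1); [apply Rle_Rpower; lra|]. rewrite Rpower_1; lra.
Qed.

(** By [christoffel_beta], [K] is the total mass over a product of two beta integrals, with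
    parameters [(al, be)] and [(al, 0)]. [Gamma_le] applies to each, which is why [Gamma] appears
    squared. The constant is [8 = 4 * 2], from the mass inequality and from [tail_le]. *)
Lemma core_bound al be f s k rho : adm al be -> be <= al -> cont f -> (s = 1 \/ s = -1) -> (1 <= k)%nat ->
  (forall n, (k <= n)%nat -> 0 <= s * E al be (fun v => f v * jp al be n v)) -> s * f 1 <= 0 ->
  E al be f <= 0 -> 0 <= rho <= 1 -> (forall v, 0 <= v < 1 - rho -> 0 <= f v) ->
  (exists v, 0 <= v <= 1 /\ f v <> 0) ->
  0 < rho /\ Gamma (al + 2) ^ 2 <= 8 * Rpower (rho * INR k ^ 2 * ((al + be + 2) * (al + 2))) (al + 1).
Proof.
  intros H Hab Hf Hs Hk Hn Hf1 HE Hrho Hpos (v1 & Hv1 & Hne).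
  pose proof H as [Ha Hb].
  assert (Hk1 : 1 <= INR k) by (change 1 with (INR 1); now apply le_INR).
  assert (HkN : INR (k - 1) = INR k - 1) by (rewrite minus_INR by easy; easy).
  set (K := sum_f_R0 (fun n => jp al be n 1 ^ 2) (k - 1)).
  set (A := E al be (fun v => Rabs (f v))).
  pose proof (sup_bound_L1 al be f s k H Hab Hf Hs Hk Hn Hf1) as HS. fold A K in HS.
  pose proof (E_abs_tail al be f (2 * A * K) rho H Hf Hrho HE Hpos HS) as HT. fold A in HT.
  pose proof (J1_pos al be H) as HJ. set (j1 := J al be (fun _ => 1)) in *.
  assert (HA0 : 0 <= A) by (apply E_ge0; auto with cont; intros; apply Rabs_pos).
  assert (HA : 0 < A).
  { destruct HA0 as [|E0]; [easy|]. exfalso. apply Hne. pose proof (HS v1 Hv1) as HS1.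
    rewrite <- E0 in HS1. replace (2 * 0 * K) with 0 in HS1 by ring. pose proof (Rabs_pos (f v1)).
    destruct (Req_dec (f v1) 0); [easy|]. pose proof (Rabs_pos_lt (f v1) H1). lra. }
  assert (H1 : j1 <= 4 * K * tail al be rho).
  { apply Rmult_le_reg_l with (A / j1); [now apply Rdiv_lt_0_compat|].
    replace (A / j1 * j1) with A by (field; lra).
    replace (A / j1 * (4 * K * tail al be rho)) with (2 * (2 * A * K) * (tail al be rho / j1)) by (field; lra). easy. }
  assert (Hr0 : 0 < rho).
  { destruct (proj1 Hrho) as [|E0]; [easy|]. exfalso. rewrite <- E0 in H1.
    unfold tail in H1. rewrite sqrt_0, asin_0, RInt_point in H1. unfold zero in H1; simpl in H1. lra. }
  split; [easy|].
  assert (H0 : adm al 0) by (split; lra).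
  set (a := al + 1). set (Y := (al + be + 2) * (al + 2)).
  assert (HY : 0 < Y) by (apply Rmult_lt_0_compat; lra).
  assert (Hk2 : 1 <= INR k ^ 2) by nra.
  (* [tail_le] covers [rho <= 3/4]; for larger [rho] the bounds [INR k >= 1] and
     [Gamma (al + 2) <= (1 + a / 2)^a] suffice. *)
  destruct (Rle_lt_dec rho (3 / 4)) as [Hsm|Hlg].
  - pose proof (tail_le al be rho H ltac:(lra)) as HTl.
    pose proof (christoffel_beta al be (k - 1) H) as HC. fold K j1 in HC.
    pose proof (m_pos al be 0 (k - 1) H) as Hm. pose proof (m_pos al 0 0 (k - 1) H0) as Hm'.
    pose proof (Gamma_le al be (k - 1) H) as G1. pose proof (Gamma_le al 0 (k - 1) H0) as G2.
    pose proof (Gamma_pos al Ha) as G0.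
    set (g := Gamma (al + 2)) in *. set (B := m al be 0 (k - 1)) in *. set (B' := m al 0 0 (k - 1)) in *.
    fold a in HTl, HC, G1, G2. rewrite HkN in G1, G2.
    replace (be + (INR k - 1) + 1 + a / 2) with (be + INR k + a / 2) in G1 by ring.
    replace (0 + (INR k - 1) + 1 + a / 2) with (INR k + a / 2) in G2 by ring.
    assert (Ha1 : 1 / 2 <= a) by (unfold a; lra).
    assert (HK : 0 < K).
    { apply Rmult_lt_reg_r with (B * (a * B')); [repeat apply Rmult_lt_0_compat; lra|]. rewrite Rmult_0_l, HC. easy. }
    assert (HBB : (a * B) * (a * B') <= 8 * Rpower rho a).
    { apply Rmult_le_reg_l with (K * / a); [apply Rmult_lt_0_compat; [|apply Rinv_0_lt_compat]; lra|].
      replace (K * / a * (a * B * (a * B'))) with (K * (B * (a * B'))) by (field; lra). rewrite HC.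
      eapply Rle_trans; [exact H1|].
      apply (Rmult_le_compat_l (4 * K)) in HTl; [|lra]. eapply Rle_trans; [exact HTl|].
      apply Req_le. field. lra. }
    set (c1 := be + INR k + a / 2) in *. set (c2 := INR k + a / 2) in *.
    assert (Hc1 : 0 < c1) by (unfold c1; lra). assert (Hc2 : 0 < c2) by (unfold c2; lra).
    (* Factor by factor, [c1 <= k (al + be + 2)] and [c2 <= k (al + 2)], using [k >= 1] and
       [al + be + 1 >= 0]. *)
    assert (Hc12 : c1 * c2 <= INR k ^ 2 * Y).
    { replace (INR k ^ 2 * Y) with ((INR k * (al + be + 2)) * (INR k * (al + 2))) by (unfold Y; ring).
      apply Rmult_le_compat; try lra; unfold c1, c2, a; nra. }
    apply Rle_trans with ((Rpower c1 a * (a * B)) * (Rpower c2 a * (a * B'))).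
    + simpl. rewrite Rmult_1_r. apply Rmult_le_compat; lra.
    + replace (Rpower c1 a * (a * B) * (Rpower c2 a * (a * B'))) with ((Rpower c1 a * Rpower c2 a) * ((a * B) * (a * B'))) by ring.
      rewrite Rpower_mult_distr by easy.
      apply Rle_trans with (Rpower (c1 * c2) a * (8 * Rpower rho a)).
      * apply Rmult_le_compat_l; [left; apply exp_pos|easy].
      * replace (Rpower (c1 * c2) a * (8 * Rpower rho a)) with (8 * (Rpower rho a * Rpower (c1 * c2) a)) by ring.
        rewrite Rpower_mult_distr by (try easy; now apply Rmult_lt_0_compat).
        apply Rmult_le_compat_l; [lra|]. apply Rle_Rpower_l; [lra|].
        rewrite Rmult_assoc. split; [repeat apply Rmult_lt_0_compat; easy|].
        apply Rmult_le_compat_l; lra.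
  - pose proof (Gamma_le al 0 0 H0) as G1. pose proof (Gamma_pos al Ha) as G0. rewrite m00_be0 in G1 by easy.
    simpl (INR 0) in G1. rewrite Rmult_1_r in G1. fold a in G1. replace (0 + 0 + 1 + a / 2) with (1 + a / 2) in G1 by ring.
    assert (Ha1 : 1 / 2 <= a) by (unfold a; lra).
    apply Rle_trans with (Rpower ((1 + a / 2) ^ 2) a).
    + replace (Rpower ((1 + a / 2) ^ 2) a) with (Rpower (1 + a / 2) a ^ 2).
      * apply pow_incr; lra.
      * simpl. rewrite !Rmult_1_r. apply Rpower_mult_distr; lra.
    + eapply Rle_trans; [now apply Rpower_ratio_bound|].
      apply Rmult_le_compat_l; [lra|]. apply Rle_Rpower_l; [lra|]. split; [repeat apply Rmult_lt_0_compat; lra|].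
      apply Rmult_le_compat; [lra| |nra|].
      * apply Rmult_le_pos; lra.
      * unfold Y, a. rewrite Rmult_comm. apply Rmult_le_compat; lra.
Qed.

(** * Transfer from the improper integral on [(-1, 1)] to [J] and [E] *)

Lemma rpow_pw x a : 0 < x -> rpow x a = pw x a.
Proof. intros; unfold rpow; rewrite pw_pos by easy. destruct (Rlt_dec 0 x); lra. Qed.

Lemma wraw_continuous al be x : -1 < x < 1 -> continuous (wraw al be) x.
Proof.
  intros Hx. apply (ex_derive_continuous (K := R_AbsRing) (V := R_NormedModule)).
  apply (ex_derive_ext_loc (fun x => pw (1 - x) al * pw (1 + x) be)).
  - assert (Hd : 0 < Rmin (1 - x) (1 + x)) by (apply Rmin_glb_lt; lra).
    exists (mkposreal _ Hd); intros y Hy.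
    unfold ball in Hy; simpl in Hy; unfold AbsRing_ball, abs, minus, plus, opp in Hy; simpl in Hy.
    pose proof (Rmin_l (1 - x) (1 + x)); pose proof (Rmin_r (1 - x) (1 + x)).
    apply Rabs_def2 in Hy. unfold wraw. rewrite !rpow_pw by lra. easy.
  - apply (ex_derive_mult (fun x => pw (1 - x) al) (fun x => pw (1 + x) be)).
    + apply (ex_derive_comp (fun t => pw t al) (fun x => 1 - x)); [|auto_derive; easy].
      eexists; apply is_derive_pw; lra.
    + apply (ex_derive_comp (fun t => pw t be) (fun x => 1 + x)); [|auto_derive; easy].
      eexists; apply is_derive_pw; lra.
Qed.

Lemma has_int_m11_unique h l1 l2 : has_int_m11 h l1 -> has_int_m11 h l2 -> l1 = l2.
Proof.
  intros H1 H2. apply cond_eq. intros eps Heps.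
  destruct (H1 (eps / 2)) as (d1 & Hd1 & HI1); [lra|]. destruct (H2 (eps / 2)) as (d2 & Hd2 & HI2); [lra|].
  set (d := Rmin 1 (Rmin d1 d2)).
  assert (Hd : 0 < d <= 1) by (split; [repeat apply Rmin_glb_lt; lra|apply Rmin_l]).
  assert (Hdd : d <= d1 /\ d <= d2).
  { unfold d. pose proof (Rmin_r 1 (Rmin d1 d2)). pose proof (Rmin_l d1 d2). pose proof (Rmin_r d1 d2). lra. }
  destruct (HI1 (-1 + d / 2) (1 - d / 2)) as (p1 & Hp1); [lra|lra|].
  destruct (HI2 (-1 + d / 2) (1 - d / 2)) as (p2 & Hp2); [lra|lra|].
  rewrite <- RInt_Reals in Hp1, Hp2. apply Rabs_lt_between in Hp1, Hp2. apply Rabs_lt_between. lra.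
Qed.

(** In [x = 2 cos^2 th - 1] one has [1 - x = 2 sin^2 th] and [1 + x = 2 cos^2 th], giving
    [2^(al + be)]; the Jacobian 4 against the 2 in [jw] gives one more 2. The map decreases, so the
    limits are swapped. *)
Lemma RInt_wraw_subst al be g a b (ta tb : R) : adm al be -> cont g ->
  0 < tb <= ta -> ta < PI / 2 -> a = 2 * cos ta ^ 2 - 1 -> b = 2 * cos tb ^ 2 - 1 ->
  RInt (fun x => g x * wraw al be x) a b =
  RInt (fun th => Rpower 2 (al + be + 1) * (g (2 * cos th ^ 2 - 1) * jw al be th)) tb ta.
Proof.
  intros H Hg Ht1 Ht2 Ea Eb.
  set (phi := fun th => 2 * cos th ^ 2 - 1). set (dphi := fun th => -4 * cos th * sin th).
  assert (Hr : forall th, 0 < th < PI / 2 -> -1 < phi th < 1).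
  { intros th Hth. destruct (sin_cos_pos th Hth) as [Hs Hc]. pose proof (sin2_cos2 th) as Hsc.
    unfold Rsqr in Hsc. unfold phi. nra. }
  rewrite Ea, Eb. fold (phi ta) (phi tb).
  rewrite <- (RInt_comp (V := R_CompleteNormedModule) (fun x => g x * wraw al be x) phi dphi).
  - rewrite <- (opp_RInt_swap (V := R_CompleteNormedModule)).
    + rewrite <- (RInt_opp (V := R_CompleteNormedModule)).
      * apply RInt_ext. rewrite Rmin_left, Rmax_right by lra. intros th Hth.
        destruct (sin_cos_pos th) as [Hs Hc]; [lra|].
        match goal with |- opp (scal ?x ?y) = ?z => change (- (x * y) = z) end. unfold wraw, jw.
        pose proof (Hr th ltac:(lra)) as Hp. rewrite !rpow_pw by lra.
        replace (1 - phi th) with (2 * sin th ^ 2) by (pose proof (sin2_cos2 th) as Hsc; unfold Rsqr in Hsc; unfold phi; lra).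
        replace (1 + phi th) with (2 * cos th ^ 2) by (unfold phi; ring).
        assert (0 < sin th ^ 2) by now apply pow_lt. assert (0 < cos th ^ 2) by now apply pow_lt.
        rewrite !pw_mult_base, !pw_sqr by lra.
        rewrite (pw_plus (sin th) _ 1), (pw_plus (cos th) _ 1), (pw_pos (sin th) 1), (pw_pos (cos th) 1), !Rpower_1 by easy.
        rewrite !Rpower_plus, Rpower_1, !(pw_pos 2) by lra. unfold dphi. fold (phi th). ring.
      * eapply ex_RInt_ext; [|apply (ex_RInt_continuous (V := R_CompleteNormedModule) (fun th => scal (dphi th) (g (phi th) * wraw al be (phi th))))].
        -- intros; reflexivity.
        -- rewrite Rmin_left, Rmax_right by lra. intros th Hth.
           apply (continuous_mult (K := R_AbsRing) dphi (fun th => g (phi th) * wraw al be (phi th))).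
           ++ apply (ex_derive_continuous (K := R_AbsRing) (V := R_NormedModule)). unfold dphi. auto_derive. easy.
           ++ apply (continuous_comp phi (fun x => g x * wraw al be x)).
              ** apply (ex_derive_continuous (K := R_AbsRing) (V := R_NormedModule)). unfold phi. auto_derive. easy.
              ** apply (continuous_mult (K := R_AbsRing) g (wraw al be)); [apply Hg|apply wraw_continuous, Hr; lra].
    + apply (ex_RInt_continuous (V := R_CompleteNormedModule) (fun th => scal (dphi th) (g (phi th) * wraw al be (phi th)))).
      rewrite Rmin_left, Rmax_right by lra. intros th Hth.
      apply (continuous_mult (K := R_AbsRing) dphi (fun th => g (phi th) * wraw al be (phi th))).
      * apply (ex_derive_continuous (K := R_AbsRing) (V := R_NormedModule)). unfold dphi. auto_derive. easy.
      * apply (continuous_comp phi (fun x => g x * wraw al be x)).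
        -- apply (ex_derive_continuous (K := R_AbsRing) (V := R_NormedModule)). unfold phi. auto_derive. easy.
        -- apply (continuous_mult (K := R_AbsRing) g (wraw al be)); [apply Hg|apply wraw_continuous, Hr; lra].
  - rewrite Rmin_right, Rmax_left by lra. intros th Hth.
    apply (continuous_mult (K := R_AbsRing) g (wraw al be)); [apply Hg|apply wraw_continuous, Hr; lra].
  - intros th _. split.
    + unfold phi, dphi. auto_derive; [easy|]. ring.
    + apply (ex_derive_continuous (K := R_AbsRing) (V := R_NormedModule)). unfold dphi. auto_derive. easy.
Qed.

Lemma ang_spec x : -1 < x < 1 ->
  let t := acos (sqrt ((1 + x) / 2)) in 0 < t < PI / 2 /\ x = 2 * cos t ^ 2 - 1.
Proof.
  intros Hx t. assert (Hs : 0 < sqrt ((1 + x) / 2) < 1).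
  { split; [apply sqrt_lt_R0; lra|]. apply Rlt_le_trans with (sqrt 1); [apply sqrt_lt_1|rewrite sqrt_1]; lra. }
  assert (HC : cos t = sqrt ((1 + x) / 2)) by (apply cos_acos; lra).
  pose proof (acos_bound (sqrt ((1 + x) / 2))) as HB. fold t in HB. split.
  - split.
    + destruct (Req_dec t 0) as [E0|]; [rewrite E0, cos_0 in HC; lra|lra].
    + destruct (Rlt_le_dec t (PI / 2)) as [|Hge]; [easy|].
      assert (cos t <= 0) by (apply cos_le_0; pose proof PI_RGT_0; lra). lra.
  - rewrite HC. simpl. rewrite Rmult_1_r, sqrt_sqrt by lra. field.
Qed.

Lemma has_int_m11_J al be g h : adm al be -> cont g ->
  (forall x, -1 < x < 1 -> h x = g x * wraw al be x) ->
  has_int_m11 h (Rpower 2 (al + be + 1) * J al be (fun v => g (2 * v - 1))).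
Proof.
  intros H Hg Hh eps Heps.
  set (G := fun th => Rpower 2 (al + be + 1) * (g (2 * cos th ^ 2 - 1) * jw al be th)).
  assert (Hg' : cont (fun v => g (2 * v - 1))) by (apply (cont_comp g); auto with cont).
  assert (HG : cont G).
  { apply cont_mult; [apply cont_const|]. now apply (cont_J_integrand al be (fun v => g (2 * v - 1))). }
  assert (HJ : Rpower 2 (al + be + 1) * J al be (fun v => g (2 * v - 1)) = RInt G 0 (PI / 2)).
  { unfold J. rewrite <- (RInt_scal (V := R_CompleteNormedModule)); [easy|].
    apply cont_ex_RInt. now apply (cont_J_integrand al be (fun v => g (2 * v - 1))). }
  rewrite HJ. pose proof PI2_pos as HP.
  destruct (continuity_ab_maj (fun x => Rabs (G x)) 0 (PI / 2)) as (c & HM & _); [lra| |].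
  { intros; apply cont_continuity_pt; auto with cont. }
  set (M := Rabs (G c)) in *. assert (HM0 : 0 <= M) by apply Rabs_pos.
  (* The two missing end pieces contribute at most [2 * eta * M < eps]; [eta <= PI / 4] keeps the
     two cut-off angles in order. *)
  set (eta := Rmin (PI / 4) (eps / (2 * (M + 1)))).
  assert (Hq : 0 < eps / (2 * (M + 1))) by (apply Rdiv_lt_0_compat; lra).
  assert (He : 0 < eta) by (apply Rmin_glb_lt; lra).
  assert (He1 : eta <= PI / 4) by apply Rmin_l.
  assert (He2 : 2 * eta * (M + 1) <= eps).
  { assert (Hr : eta <= eps / (2 * (M + 1))) by apply Rmin_r.
    apply (Rmult_le_compat_r (2 * (M + 1))) in Hr; [|lra]. field_simplify in Hr; lra. }
  assert (Hse : 0 < sin eta) by (apply sin_gt_0; lra).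
  assert (Hce : 0 < cos eta) by (apply cos_gt_0; lra).
  assert (Hsc : sin eta ^ 2 + cos eta ^ 2 = 1) by (pose proof (sin2_cos2 eta) as Hsc; unfold Rsqr in Hsc; lra).
  assert (Hle : sin eta <= cos eta).
  { rewrite <- sin_shift. destruct (Req_dec eta (PI / 4)) as [->|]; [apply Req_le; f_equal; lra|].
    left. apply sin_increasing_1; lra. }
  (* Since [1 - 2 sin^2 eta = 2 cos^2 eta - 1], a distance below [2 sin^2 eta] from an endpoint of
     [I] is an angle below [eta] from the corresponding endpoint of [[0, PI / 2]]. *)
  exists (2 * sin eta ^ 2). split; [apply Rmult_lt_0_compat; [lra|now apply pow_lt]|].
  intros a b Ha Hb.
  assert (Ha' : -1 < a < 1) by nra. assert (Hb' : -1 < b < 1) by nra.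
  destruct (ang_spec a Ha') as [Hta Ea]. destruct (ang_spec b Hb') as [Htb Eb].
  set (ta := acos (sqrt ((1 + a) / 2))) in *. set (tb := acos (sqrt ((1 + b) / 2))) in *.
  destruct (sin_cos_pos ta Hta) as [Hsa Hca]. destruct (sin_cos_pos tb Htb) as [Hsb Hcb].
  assert (H1 : tb < eta).
  { destruct (Rlt_le_dec tb eta) as [|Hge]; [easy|]. exfalso.
    assert (cos tb <= cos eta) by (apply cos_decr_1; lra).
    assert (cos tb ^ 2 <= cos eta ^ 2) by (apply pow_incr; lra). lra. }
  assert (H2 : PI / 2 - eta < ta).
  { destruct (Rlt_le_dec (PI / 2 - eta) ta) as [|Hge]; [easy|]. exfalso.
    assert (Hc : cos (PI / 2 - eta) <= cos ta) by (apply cos_decr_1; lra).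
    rewrite cos_shift in Hc.
    assert (sin eta ^ 2 <= cos ta ^ 2) by (apply pow_incr; lra). lra. }
  assert (Hab : a <= b).
  { assert (cos ta <= cos tb) by (apply cos_decr_1; lra).
    assert (cos ta ^ 2 <= cos tb ^ 2) by (apply pow_incr; lra). lra. }
  assert (Hex : ex_RInt h a b).
  { apply ex_RInt_ext with (fun x => g x * wraw al be x).
    - rewrite Rmin_left, Rmax_right by easy. intros x Hx; symmetry; apply Hh; lra.
    - apply (ex_RInt_continuous (V := R_CompleteNormedModule)). rewrite Rmin_left, Rmax_right by easy. intros x Hx.
      apply (continuous_mult (K := R_AbsRing) g (wraw al be)); [apply Hg|apply wraw_continuous; lra]. }
  exists (ex_RInt_Reals_0 _ _ _ Hex). rewrite <- RInt_Reals.
  rewrite (RInt_ext h (fun x => g x * wraw al be x)).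
  2:{ rewrite Rmin_left, Rmax_right by easy. intros x Hx; apply Hh; lra. }
  rewrite (RInt_wraw_subst al be g a b ta tb) by (easy || lra). fold G.
  rewrite <- (RInt_Chasles (V := R_CompleteNormedModule) G 0 tb (PI / 2)) by now apply cont_ex_RInt.
  rewrite <- (RInt_Chasles (V := R_CompleteNormedModule) G tb ta (PI / 2)) by now apply cont_ex_RInt.
  unfold plus; simpl.
  assert (HB1 : Rabs (RInt G 0 tb) <= (tb - 0) * M).
  { apply abs_RInt_le_const; [lra|now apply cont_ex_RInt|]. intros; apply HM; lra. }
  assert (HB2 : Rabs (RInt G ta (PI / 2)) <= (PI / 2 - ta) * M).
  { apply abs_RInt_le_const; [lra|now apply cont_ex_RInt|]. intros; apply HM; lra. }
  apply Rabs_le_between in HB1, HB2. apply Rabs_lt_between.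
  assert ((tb - 0) * M <= eta * M) by (apply Rmult_le_compat_r; lra).
  assert ((PI / 2 - ta) * M <= eta * M) by (apply Rmult_le_compat_r; lra). lra.
Qed.

Lemma Int_m11_J al be g h : adm al be -> cont g ->
  (forall x, -1 < x < 1 -> h x = g x * wraw al be x) ->
  Int_m11 h = Rpower 2 (al + be + 1) * J al be (fun v => g (2 * v - 1)).
Proof.
  intros H Hg Hh. pose proof (has_int_m11_J al be g h H Hg Hh) as HI.
  apply has_int_m11_unique with h; [|easy].
  apply (epsilon_spec (inhabits 0) (has_int_m11 h)). exact (ex_intro _ _ HI).
Qed.

(** The factor [2^(al + be + 1)] occurs in this integral and in the one that defines [cw], and
    cancels. *)
Lemma Int_m11_E al be q h : adm al be -> cont q ->
  (forall x, -1 < x < 1 -> h x = q x * w al be x) ->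
  Int_m11 h = E al be (fun v => q (2 * v - 1)).
Proof.
  intros H Hq Hh.
  assert (Hc : cw al be = / (Rpower 2 (al + be + 1) * J al be (fun _ => 1))).
  { unfold cw. f_equal. apply (Int_m11_J al be (fun _ => 1)); auto with cont. intros; ring. }
  rewrite (Int_m11_J al be (fun x => cw al be * q x)); auto with cont.
  2:{ intros x Hx. rewrite Hh by easy. unfold w. ring. }
  rewrite (J_scal al be (cw al be) (fun v => q (2 * v - 1))); [|easy|apply (cont_comp q); auto with cont].
  rewrite Hc. unfold E. pose proof (J1_pos al be H). pose proof (exp_pos ((al + be + 1) * ln 2)) as Hx.
  fold (Rpower 2 (al + be + 1)) in Hx. field. split; lra.
Qed.

Lemma jnorm_eq al be n : adm al be -> jnorm al be n = sqrt (jh al be n).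
Proof.
  intros H. unfold jnorm. f_equal.
  rewrite (Int_m11_E al be (fun x => jy al be n ((1 + x) / 2) ^ 2)); [|easy| |].
  - unfold jh. apply E_ext; intros. now replace ((1 + (2 * v - 1)) / 2) with v by field.
  - apply cont_pow. apply (cont_comp (jy al be n)); auto with cont.
  - intros x Hx. rewrite <- jacobiP_jy. now replace (2 * ((1 + x) / 2) - 1) with x by field.
Qed.

Lemma jacobip_jp al be n x : adm al be -> jacobip al be n x = jp al be n ((1 + x) / 2).
Proof.
  intros H. unfold jacobip, jp. rewrite jnorm_eq, <- jacobiP_jy by easy.
  now replace (2 * ((1 + x) / 2) - 1) with x by field.
Qed.

(** A 1-Lipschitz retraction onto [I]: composing with it turns continuity within [I] into [cont] and
    changes no value on [I]. *)
Definition clamp (x : R) : R := Rmax (-1) (Rmin 1 x).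

Lemma clamp_id x : -1 <= x <= 1 -> clamp x = x.
Proof. intros; unfold clamp; rewrite Rmin_right, Rmax_right; lra. Qed.

Lemma clamp_Iset x : Iset (clamp x).
Proof.
  unfold Iset, clamp. split; [apply Rmax_l|]. apply Rmax_lub; [lra|apply Rmin_l].
Qed.

Lemma clamp_lip x y : Rabs (clamp x - clamp y) <= Rabs (x - y).
Proof.
  unfold clamp, Rmax, Rmin. repeat destruct Rle_dec; unfold Rabs; repeat destruct Rcase_abs; lra.
Qed.

Lemma cont_clamp f : (forall x, Iset x -> continue_in f Iset x) -> cont (fun x => f (clamp x)).
Proof.
  intros Hf x. apply continuity_pt_filterlim. intros eps Heps.
  destruct (Hf (clamp x) (clamp_Iset x) eps Heps) as (d & Hd & HD).
  exists d. split; [easy|]. intros y [_ Hy]. simpl in *. unfold Rdist in *.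
  (* [continue_in] speaks only of points different from the base point, so coinciding clamped points
     are treated apart. *)
  destruct (Req_dec (clamp x) (clamp y)) as [->|Hne]; [rewrite Rminus_diag, Rabs_R0; lra|].
  apply HD. split; [split; [apply clamp_Iset|easy]|].
  pose proof (clamp_lip y x). lra.
Qed.

Lemma fhat_E al be f n : adm al be -> (forall x, Iset x -> continue_in f Iset x) ->
  fhat al be f n = E al be (fun v => f (clamp (2 * v - 1)) * jp al be n v).
Proof.
  intros H Hf. unfold fhat. pose proof (cont_clamp f Hf) as Hc.
  rewrite (Int_m11_E al be (fun x => f (clamp x) * jp al be n ((1 + x) / 2))); [|easy| |].
  - apply E_ext; intros. now replace ((1 + (2 * v - 1)) / 2) with v by field.
  - apply cont_mult; [easy|]. apply (cont_comp (jp al be n)); auto with cont.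
  - intros x Hx. rewrite jacobip_jp, clamp_id by (easy || lra). easy.
Qed.

(** Nonnegativity survives at the infimum because the range of [x] is half-open: any [x < 1 - rI f]
    also satisfies [x < 1 - r] for some admissible [r]. Only [0 <= rI f] is obtained here; strict
    positivity, for the functions at issue, comes out of [core_bound]. *)
Lemma rI_spec f : 0 <= rI f <= 2 /\ forall x, -1 <= x < 1 - rI f -> 0 <= f x.
Proof.
  set (P := fun r => 0 < r <= 2 /\ forall x, -1 <= x < 1 - r -> 0 <= f x).
  assert (H2 : P 2) by (split; [lra|intros; lra]).
  assert (HG : Defs.is_glb P (rI f)).
  { apply (epsilon_spec (inhabits 0) (Defs.is_glb P)).
    destruct (completeness (fun y => P (- y))) as (l & Hl1 & Hl2).
    - exists 0. intros y [Hy _]. lra.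
    - exists (-2). now replace (- -2) with 2 by ring.
    - exists (- l). split.
      + intros r Hr. assert (- r <= l) by (apply Hl1; now rewrite Ropp_involutive). lra.
      + intros m' Hm. assert (l <= - m'); [|lra]. apply Hl2. intros y Hy. specialize (Hm _ Hy). lra. }
  destruct HG as [HG1 HG2]. split; [split|].
  - apply HG2. intros r [Hr _]. lra.
  - now apply HG1.
  - intros x Hx. apply NNPP. intros Hn. assert (1 - x <= rI f); [|lra].
    apply HG2. intros r [Hr Hr']. apply Rnot_lt_le. intros Hlt. apply Hn, Hr'. lra.
Qed.

Lemma least_nat (P : nat -> Prop) n : P n -> exists k, P k /\ forall j, P j -> (k <= j)%nat.
Proof.
  induction n as [n IH] using lt_wf_ind. intros Hn.
  destruct (classic (exists j, (j < n)%nat /\ P j)) as [(j & Hj & Pj)|HN]; [now apply (IH j)|].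
  exists n. split; [easy|]. intros j Pj. apply Nat.nlt_ge. intros Hj. apply HN. now exists j.
Qed.

Lemma kidx_spec s al be f : (exists N, forall n, (N <= n)%nat -> 0 <= s * fhat al be f n) ->
  (1 <= kidx s al be f)%nat /\ (forall n, (kidx s al be f <= n)%nat -> 0 <= s * fhat al be f n) /\
  forall j, (1 <= j)%nat -> (forall n, (j <= n)%nat -> 0 <= s * fhat al be f n) -> (kidx s al be f <= j)%nat.
Proof.
  intros (N & HN). unfold kidx.
  apply (epsilon_spec (inhabits 0%nat) (fun k => (1 <= k)%nat /\ (forall n, (k <= n)%nat -> 0 <= s * fhat al be f n) /\
     forall j, (1 <= j)%nat -> (forall n, (j <= n)%nat -> 0 <= s * fhat al be f n) -> (k <= j)%nat)).
  destruct (least_nat (fun k => (1 <= k)%nat /\ forall n, (k <= n)%nat -> 0 <= s * fhat al be f n) (S N)) as (k & [Hk1 Hk2] & Hk3).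
  - split; [lia|]. intros; apply HN; lia.
  - exists k. repeat split; try easy. intros; now apply Hk3.
Qed.

Lemma lower_bound al be s : adm al be -> be <= al -> (s = 1 \/ s = -1) ->
  inf_ge (Bvals s al be)
    (2 * Rpower (Gamma (al + 2)) (2 / (al + 1))
        / (Rpower (4 * exp (1/12)) (2 / (al + 1)) * (al + be + 2) * (al + 2))).
Proof.
  intros H Hab Hs v (f & (Hf & Hf0 & Hev & Hf1) & (x0 & Hx0 & Hne) & ->).
  destruct (rI_spec f) as [Hr Hpos]. destruct (kidx_spec s al be f Hev) as (Hk1 & Hk2 & _).
  set (r := rI f) in *. set (k := kidx s al be f) in *. pose proof H as [Ha Hb].
  assert (Hk0 : 1 <= INR k) by (change 1 with (INR 1); now apply le_INR).
  set (F := fun v => f (clamp (2 * v - 1))).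
  assert (HF : cont F) by (apply (cont_comp (fun x => f (clamp x)) (fun v => 2 * v - 1)); [now apply cont_clamp|auto with cont]).
  (* Lengths are halved by [v = (1 + x) / 2]; this is the origin of the leading 2 in the bound. *)
  destruct (core_bound al be F s k (r / 2)) as [Hr0 HG]; try easy.
  - intros n Hn. pose proof (Hk2 n Hn) as Hk2n. now rewrite fhat_E in Hk2n.
  - unfold F. replace (2 * 1 - 1) with 1 by ring. now rewrite clamp_id by lra.
  - rewrite fhat_E in Hf0 by easy.
    rewrite (E_ext al be F (fun v => f (clamp (2 * v - 1)) * jp al be 0 v)); [easy|].
    intros; unfold F. rewrite jp_0_eq by easy. ring.
  - lra.
  - intros u Hu. unfold F. rewrite clamp_id by lra. apply Hpos. lra.
  - exists ((1 + x0) / 2). unfold Iset in Hx0. split; [lra|]. unfold F.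
    replace (2 * ((1 + x0) / 2) - 1) with x0 by field. now rewrite clamp_id.
  - pose proof (Gamma_pos al Ha) as G0. set (g := Gamma (al + 2)) in *.
    set (C := 4 * exp (1 / 12)). set (Y := (al + be + 2) * (al + 2)) in *.
    assert (HY : 0 < Y) by (apply Rmult_lt_0_compat; lra).
    (* So [C^2 > 16], which covers the constant 8 of [core_bound]. *)
    assert (HC : 4 < C) by (unfold C; pose proof (exp_ineq1 (1 / 12) ltac:(lra)); lra).
    set (Z := r / 2 * INR k ^ 2 * Y) in *.
    assert (HZ : 0 < Z) by (unfold Z; repeat apply Rmult_lt_0_compat; try lra; apply pow_lt; lra).
    assert (HD : 0 < Rpower C (2 / (al + 1))) by apply exp_pos.
    assert (Hfin : Rpower g (2 / (al + 1)) <= Rpower C (2 / (al + 1)) * Z).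
    { assert (HP2 : forall x, 0 < x -> Rpower x (2 / (al + 1)) = Rpower (x ^ 2) (/ (al + 1))).
      { intros x Hx. rewrite <- (Rpower_pow 2 x), Rpower_mult by easy. f_equal. }
      rewrite !HP2 by lra.
      replace Z with (Rpower (Rpower Z (al + 1)) (/ (al + 1))) by (rewrite Rpower_mult, Rinv_r, Rpower_1; lra).
      rewrite Rpower_mult_distr; [|apply pow_lt; lra|apply exp_pos].
      apply Rle_Rpower_l; [left; apply Rinv_0_lt_compat; lra|]. split; [now apply pow_lt|].
      eapply Rle_trans; [exact HG|]. apply Rmult_le_compat_r; [left; apply exp_pos|]. nra. }
    replace (r * INR k ^ 2) with (2 * (Rpower C (2 / (al + 1)) * Z) / (Rpower C (2 / (al + 1)) * (al + be + 2) * (al + 2))).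
    + apply Rmult_le_compat_r; [|lra]. left. apply Rinv_0_lt_compat. repeat apply Rmult_lt_0_compat; lra.
    + unfold Z, Y. field. repeat split; lra.
Qed.

(** * Test functions for the upper bounds *)

Lemma cont_continue_in f x : cont f -> continue_in f Iset x.
Proof.
  intros Hf eps Heps. destruct (cont_continuity_pt f x Hf eps Heps) as (d & Hd & HD).
  exists d. split; [easy|]. intros y [[Hy1 Hy2] Hy3]. apply HD. split; [|easy]. split; [exact I|easy].
Qed.

Lemma E_jp_delta al be n k : adm al be ->
  E al be (fun v => jp al be n v * jp al be k v) = if Nat.eq_dec n k then 1 else 0.
Proof.
  intros H. destruct (Nat.eq_dec n k) as [->|Hn]; [now apply E_jp_sqr|now apply E_jp_jp].
Qed.

Lemma fhat_jp_minus al be c n : adm al be ->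
  fhat al be (fun x => jp al be 1 ((1 + x) / 2) - c) n =
  (if Nat.eq_dec 1 n then 1 else 0) - c * (if Nat.eq_dec 0 n then 1 else 0).
Proof.
  intros H.
  assert (Hc : cont (fun x => jp al be 1 ((1 + x) / 2) - c)).
  { apply cont_minus; [|apply cont_const]. apply (cont_comp (jp al be 1)); auto with cont. }
  rewrite fhat_E by (try easy; intros; now apply cont_continue_in).
  rewrite (E_ext al be _ (fun v => jp al be 1 v * jp al be n v - c * (jp al be 0 v * jp al be n v))).
  2:{ intros v Hv. rewrite clamp_id, jp_0_eq by (easy || lra).
      replace ((1 + (2 * v - 1)) / 2) with v by field. ring. }
  rewrite (E_minus al be (fun v => jp al be 1 v * jp al be n v) (fun v => c * (jp al be 0 v * jp al be n v))) by auto with cont.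
  rewrite (E_scal al be c (fun v => jp al be 0 v * jp al be n v)) by auto with cont.
  now rewrite !E_jp_delta.
Qed.

(** Since [jp al be 0] is 1, the coefficients of the test function are [- c] at 0, 1 at 1 and 0
    beyond; thus [0 <= c] is the condition on the mean. *)
Lemma jp_minus_mem al be s c k : adm al be -> 0 <= c -> (1 <= k)%nat ->
  (forall n, (k <= n)%nat -> 0 <= s * fhat al be (fun x => jp al be 1 ((1 + x) / 2) - c) n) ->
  s * (jp al be 1 1 - c) <= 0 -> inf_le (Bvals s al be) (2 * INR k ^ 2).
Proof.
  intros H Hc Hk Hn Hs eps Heps. set (f := fun x => jp al be 1 ((1 + x) / 2) - c) in *.
  assert (Hcf : forall x, Iset x -> continue_in f Iset x).
  { intros x _. apply cont_continue_in, cont_minus; [|apply cont_const]. apply (cont_comp (jp al be 1)); auto with cont. }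
  assert (Hev : exists N, forall n, (N <= n)%nat -> 0 <= s * fhat al be f n) by (now exists k).
  exists (rI f * INR (kidx s al be f) ^ 2). split.
  - exists f. split; [|split; [|easy]].
    + split; [easy|]. split; [|split; [easy|]].
      * unfold f. rewrite fhat_jp_minus by easy. simpl. lra.
      * unfold f. now replace ((1 + 1) / 2) with 1 by field.
    (* The function is not zero on [I], as its coefficient of index 1 is 1. *)
    + apply NNPP. intros HN.
      assert (H0 : forall x, Iset x -> f x = 0).
      { intros x Hx. apply NNPP. intros Hx'. apply HN. now exists x. }
      assert (Hf1 : fhat al be f 1 = 1) by (unfold f; rewrite fhat_jp_minus by easy; simpl; ring).
      rewrite fhat_E in Hf1 by easy.
      rewrite (E_ext al be _ (fun _ => 0)), E_const in Hf1 by solve [easy | intros; rewrite H0; [ring|apply clamp_Iset]]. lra.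
  - destruct (rI_spec f) as [Hr _]. destruct (kidx_spec s al be f Hev) as (_ & _ & Hk3).
    pose proof (Hk3 k Hk Hn) as Hkk. apply le_INR in Hkk.
    assert (HI : INR (kidx s al be f) ^ 2 <= INR k ^ 2) by (apply pow_incr; split; [apply pos_INR|easy]).
    assert (rI f * INR (kidx s al be f) ^ 2 <= 2 * INR k ^ 2); [|lra].
    apply Rmult_le_compat; try lra. apply pow2_ge_0.
Qed.

Theorem mainTheorem7 (al be : R) (hab : be <= al) (hb : -1/2 <= be) :
  (forall s : R, (s = 1 \/ s = -1) ->
     inf_ge (Bvals s al be)
       (2 * Rpower (Gamma (al + 2)) (2 / (al + 1))
        / (Rpower (4 * exp (1/12)) (2 / (al + 1)) * (al + be + 2) * (al + 2)))) /\
  inf_le (Bvals 1 al be) 2 /\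
  inf_le (Bvals (-1) al be) 8.
Proof.
  assert (H : adm al be) by (split; lra). pose proof (jp_1_pos al be 1 H) as Hp.
  split; [intros s Hs; now apply lower_bound|split].
  - replace 2 with (2 * INR 1 ^ 2) by (simpl; ring).
    apply jp_minus_mem with (jp al be 1 1); try easy; try lra.
    intros n Hn. rewrite fhat_jp_minus by easy.
    destruct (Nat.eq_dec 0 n); [lia|]. destruct (Nat.eq_dec 1 n); lra.
  - replace 8 with (2 * INR 2 ^ 2) by (simpl; ring).
    apply jp_minus_mem with 0; try easy; try lra; try lia.
    intros n Hn. rewrite fhat_jp_minus by easy.
    destruct (Nat.eq_dec 1 n); [lia|]. lra.
Qed.
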